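(* Let $X$ be an infinite dimensional complex Banach space, let $T\in L(X)$ be a B-Fredholm operator and let $d=\mathrm{dis}(T)$. Then $\mathcal R(T^* )+\mathcal N((T^* )^d)$ is closed in $\sigma(X^*,X)$, and $T^*$ is a B-Fredholm operator with $\alpha(T_{[d]})=\beta(T^*_{[d]})$, $\beta(T_{[d]})=\alpha(T^*_{[d]})$ and $\mathrm{ind}(T)=\mathrm{ind}(T_{[d]})=-\mathrm{ind}(T^*_{[d]})=-\mathrm{ind}(T^* )$.
   Context: $L(X)$ is the algebra of bounded operators on $X$; $X^*$ is the topological dual of $X$, $T^*\in L(X^* )$ the adjoint of $T$, and $\sigma(X^*,X)$ the weak*-topology on $X^*$. $\mathcal N(S)$, $\mathcal R(S)$ denote the kernel and range of an operator $S$; $\alpha(S)=\dim\mathcal N(S)$ and $\beta(S)=\mathrm{codim}\,\mathcal R(S)$ (codimension in the space on which $S$ acts) for the operators $T_{[d]}$, $T^*_{[d]}$ appearing in the statement. A bounded operator $S$ on a Banach space is Fredholm if $\mathcal R(S)$ is closed, $\dim\mathcal N(S)<\infty$ and $\mathrm{codim}\,\mathcal R(S)<\infty$, with $\mathrm{ind}(S)=\dim\mathcal N(S)-\mathrm{codim}\,\mathcal R(S)$. For an operator $S$ on a Banach space and $n\in\mathbb N$ (including $0$), $S_{[n]}:\mathcal R(S^n)\to\mathcal R(S^n)$ is the restriction of $S$ to $\mathcal R(S^n)$; $T^*_{[d]}$ means $(T^* )_{[d]}$. $S$ is B-Fredholm if for some integer $n\ge0$ the range $\mathcal R(S^n)$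 is closed and $S_{[n]}$ is Fredholm; its index is $\mathrm{ind}(S):=\mathrm{ind}(S_{[n]})$ for any such $n$ (independent of $n$). The degree of stable iteration is $\mathrm{dis}(T)=\inf\{m\in\mathbb N:\mathcal R(T^m)\cap\mathcal N(T)=\mathcal R(T^r)\cap\mathcal N(T)\ \text{for all integers } r\ge m\}$, with $\inf\emptyset=\infty$; it is finite for B-Fredholm operators. *)

(* Defs.v *)
From HB Require Import structures.
From mathcomp Require Import all_boot all_order all_algebra.
From mathcomp Require Import all_classical all_reals all_analysis.
From mathcomp Require Import complex.

Set Implicit Arguments.
Unset Strict Implicit.
Unset Printing Implicit Defensive.

Import Order.TTheory GRing.Theory Num.Theory.
Import numFieldNormedType.Exports.

Local Open Scope classical_set_scope.
Local Open Scope ring_scope.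
Local Open Scope complex_scope.

Section BoundedOperators.
Context {R : realType} {V : normedModType R[i]}.
Implicit Types (S : V -> V) (M N : set V).

Structure bounded_operator := BoundedOperator {
  bounded_operator_fun :> {linear V -> V};
  bounded_operator_continuous : continuous bounded_operator_fun }.

Definition ker S : set V := [set x | S x = 0].

(* For subspaces N <= M, the classes of the e i form a basis of M / N. *)
Definition basis_mod M N n (e : 'I_n -> V) : Prop :=
  (forall i, M (e i)) /\
  (forall x, M x -> exists! c : 'I_n -> R[i], N (x - \sum_i c i *: e i)).

(* dim (M / N), equal to +oo when M / N has no finite basis. *)
Definition dim_mod M N : \bar R :=
  ereal_inf [set n%:R%:E | n in
    [set n | exists e : 'I_n -> V, basis_mod M N e]].

Definition dimension M : \bar R := dim_mod M [set 0].

Definition codimension M N : \bar R := dim_mod M N.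

Definition iter_range S n : set V := range (iter n S).

(* S_[n], the restriction of S to R(S^n), has kernel R(S^n) `&` N(S) and range
   S(R(S^n)). *)
Definition alpha S n : \bar R := dimension (iter_range S n `&` ker S).

Definition beta S n : \bar R :=
  codimension (iter_range S n) (S @` iter_range S n).

Definition fredholm_restr S n : Prop :=
  [/\ closed (S @` iter_range S n : set (subspace (iter_range S n))),
      (alpha S n < +oo)%E & (beta S n < +oo)%E].

Definition b_fredholm_at S n : Prop :=
  closed (iter_range S n) /\ fredholm_restr S n.

Definition b_fredholm S : Prop := exists n, b_fredholm_at S n.

(* ind(S_[n]). The index is only defined for a Fredholm operator on a Banach
   space; otherwise it gets the value -oo, which is not the index of any
   Fredholm operator. *)
Definition index_restr S n : \bar R :=
  (if `[< b_fredholm_at S n >] then alpha S n - beta S n else -oo)%E.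

(* All n with b_fredholm_at S n give the same index, so the choice made by xget
   is immaterial. *)
Definition b_index S : \bar R :=
  index_restr S (xget 0%N [set n | b_fredholm_at S n]).

Definition dis S : \bar R :=
  ereal_inf [set m%:R%:E | m in
    [set m | forall r, (m <= r)%N ->
       iter_range S m `&` ker S = iter_range S r `&` ker S]].

End BoundedOperators.

Arguments bounded_operator {R} V.


Section DualSpace.
Context {R : realType}.
Local Notation C := (R[i]^o).
Variable X : normedModType R[i].

Definition dual_pred : {pred X -> C} :=
  fun f => `[< linear f /\ continuous f >].

Lemma dual_pred_submod_closed : submod_closed dual_pred.
Proof.
split.
  apply/asboolP; split; last by move=> x; exact: cvg_cst.
  by move=> a u v; rewrite /= scaler0 addr0.
move=> a f g /asboolP[lf cf] /asboolP[lg cg]; apply/asboolP; split.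
  move=> b u v; rewrite !fctE /= lf lg !scalerDr !scalerA (mulrC a b).
  by rewrite addrACA.
move=> x; apply: cvgD; last exact: cg.
by apply: cvgZl_tmp; exact: cf.
Qed.

HB.instance Definition _ :=
  GRing.isSubmodClosed.Build R[i] (X -> C) dual_pred dual_pred_submod_closed.

Definition dual_space := {f : X -> C | f \in dual_pred}.

HB.instance Definition _ := SubType.on dual_space.
HB.instance Definition _ := Choice.on dual_space.
HB.instance Definition _ := [SubChoice_isSubLmodule of dual_space by <:].

Definition dual_fun (f : dual_space) : X -> C := val f.

Lemma dual_fun_is_linear (f : dual_space) : linear (dual_fun f).
Proof. by have /asboolP[] := valP f. Qed.

HB.instance Definition _ (f : dual_space) :=
  GRing.isLinear.Build R[i] X C *:%R (dual_fun f) (dual_fun_is_linear f).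

Lemma dual_fun_continuous (f : dual_space) : continuous (dual_fun f).
Proof. by have /asboolP[] := valP f. Qed.

Definition dual_norm (f : dual_space) : R :=
  sup [set complex.Re `|dual_fun f x| | x in [set x | `|x| <= 1]].

Let ReK (z : R[i]) : 0 <= z -> (complex.Re z)%:C = z.
Proof. by case: z => a b; rewrite lecE /= => /andP[/eqP -> _]. Qed.

Let Re_le (z w : R[i]) : z <= w -> complex.Re z <= complex.Re w.
Proof. by rewrite lecE => /andP[]. Qed.

Let dual_norm_has_sup (f : dual_space) :
  has_sup [set complex.Re `|dual_fun f x| | x in [set x | `|x| <= 1]].
Proof.
split; first by exists (complex.Re `|dual_fun f 0|), 0; rewrite //= normr0.
have /linear_bounded_continuous/bounded_funP/(_ 1)[M fM] :=
  @dual_fun_continuous f.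
exists (complex.Re M) => _ [x x1 <-]; apply: Re_le; exact: fM.
Qed.

Let dual_norm_ub (f : dual_space) x :
  `|x| <= 1 -> complex.Re `|dual_fun f x| <= dual_norm f.
Proof. by move=> x1; apply: ub_le_sup; [case: (dual_norm_has_sup f)|exists x]. Qed.

Lemma ler_dual_norm (f : dual_space) x :
  `|dual_fun f x| <= (dual_norm f)%:C * `|x|.
Proof.
have [->|x0] := eqVneq x 0; first by rewrite linear0 !normr0 mulr0.
have nx0 : 0 < `|x| by rewrite normr_gt0.
have x1 : `|(`|x|^-1 : R[i]) *: x| <= 1.
  by rewrite normrZ normfV normr_id mulVf ?gt_eqF.
have := dual_norm_ub f x1; rewrite -(@lecR R) ReK // linearZ normrZ normfV normr_id.
by rewrite ler_pdivrMl // mulrC.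
Qed.

Lemma dual_norm_le (f : dual_space) (M : R) :
  (forall x, `|x| <= 1 -> `|dual_fun f x| <= M%:C) -> dual_norm f <= M.
Proof.
move=> fM; apply: ge_sup; first by case: (dual_norm_has_sup f).
by move=> _ [x x1 <-]; apply: (@Re_le _ M%:C); exact: fM.
Qed.

Lemma dual_norm_ge0 (f : dual_space) : 0 <= dual_norm f.
Proof.
apply: le_trans (@dual_norm_ub f 0 _); last by rewrite normr0.
exact: (Re_le (normr_ge0 _)).
Qed.

Let normC (f : dual_space) : R[i] := (dual_norm f)%:C.

Let normC_ler_normD (f g : dual_space) : normC (f + g) <= normC f + normC g.
Proof.
rewrite /normC -rmorphD lecR; apply: dual_norm_le => x x1.
rewrite (le_trans (ler_normD _ _)) // rmorphD lerD //.
  by rewrite (le_trans (ler_dual_norm _ _)) // ler_piMr // ler0c dual_norm_ge0.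
by rewrite (le_trans (ler_dual_norm _ _)) // ler_piMr // ler0c dual_norm_ge0.
Qed.

Let normC_Z_le (a : R[i]) (f : dual_space) : normC (a *: f) <= `|a| * normC f.
Proof.
have aE : (complex.Re `|a| * dual_norm f)%:C = `|a| * normC f.
  by rewrite rmorphM; congr (_ * _); exact: ReK.
rewrite -aE lecR; apply: dual_norm_le => x x1; rewrite aE.
have -> : dual_fun (a *: f) x = a *: dual_fun f x by [].
rewrite normrZ; apply: ler_wpM2l => //.
by rewrite (le_trans (ler_dual_norm _ _)) // ler_piMr // ler0c dual_norm_ge0.
Qed.

Let normC_eq0 (f : dual_space) : normC f = 0 -> f = 0.
Proof.
rewrite /normC => f0; apply/val_inj/funext => x.
apply/eqP; rewrite -normr_le0.
by rewrite (le_trans (ler_dual_norm f x)) // f0 mul0r.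
Qed.

Let normC_Z (a : R[i]) (f : dual_space) : normC (a *: f) = `|a| * normC f.
Proof.
apply/eqP; rewrite eq_le normC_Z_le /=.
have [->|a0] := eqVneq a 0.
  by rewrite normr0 mul0r scale0r /normC ler0c dual_norm_ge0.
have := normC_Z_le a^-1 (a *: f).
by rewrite scalerA mulVf // scale1r normfV -ler_pdivrMl ?invr_gt0 ?normr_gt0 // invrK.
Qed.

HB.instance Definition _ := Lmodule_isNormed.Build R[i] dual_space
  normC_ler_normD normC_Z normC_eq0.

Lemma dual_normE (f : dual_space) : `|f| = (dual_norm f)%:C.
Proof. by []. Qed.

(* sigma(X^*, X): the initial topology of the embedding of X^* into X -> C with
   the topology of pointwise convergence *)
Definition weak_star_closed (A : set dual_space) : Prop :=
  closed (A : set (initial_topology (dual_fun : dual_space -> {ptws X -> C}))).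

End DualSpace.

Section Adjoint.
Context {R : realType} {X : normedModType R[i]}.
Local Notation C := (R[i]^o).
Variable T : bounded_operator X.

Lemma adjoint_subproof (f : dual_space X) : (dual_fun f \o T) \in @dual_pred R X.
Proof.
apply/asboolP; split; first by move=> a u v; rewrite /= !linearP.
move=> x; apply: continuous_comp; first exact: bounded_operator_continuous.
exact: dual_fun_continuous.
Qed.

Definition adjoint_fun (f : dual_space X) : dual_space X :=
  exist _ (dual_fun f \o T) (adjoint_subproof f).

Lemma adjoint_fun_is_linear : linear adjoint_fun.
Proof. by move=> a f g; apply/val_inj. Qed.

HB.instance Definition _ := GRing.isLinear.Build R[i]
  (dual_space X) (dual_space X) *:%R adjoint_fun adjoint_fun_is_linear.

Lemma adjoint_fun_continuous : continuous adjoint_fun.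
Proof.
apply/linear_bounded_continuous/bounded_funP => r.
have /linear_bounded_continuous/bounded_funP/(_ 1)[M TM] :=
  @bounded_operator_continuous _ _ T.
have M0 : 0 <= M by apply: le_trans (TM 0 _); rewrite ?normr0.
exists (r * M) => f fr.
have rM0 : 0 <= r * M by rewrite mulr_ge0 // (le_trans _ fr).
rewrite dual_normE.
have rMK : (complex.Re (r * M))%:C = r * M.
  by move: rM0; case: (r * M) => a b; rewrite lecE /= => /andP[/eqP -> _].
rewrite -rMK lecR; apply: dual_norm_le => x x1; rewrite rMK.
by rewrite (le_trans (ler_dual_norm f (T x))) // -dual_normE ler_pM // TM.
Qed.

Definition adjoint : bounded_operator (dual_space X) :=
  BoundedOperator adjoint_fun_continuous.

End Adjoint.

(* Main.v *)
From HB Require Import structures.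
Require Import Defs.
From mathcomp Require Import all_boot all_order all_algebra.
From mathcomp Require Import all_classical all_reals all_analysis.
From mathcomp Require Import complex.
From mathcomp Require Import zify ring lra.
Import Order.TTheory GRing.Theory Num.Theory.
Import numFieldNormedType.Exports.
Local Open Scope classical_set_scope.
Local Open Scope ring_scope.

(** Let K denote the kernel of T, and R_n and K_n the range and the kernel of T^n.

    T maps R_n / R_(n+1) onto R_(n+1) / R_(n+2), and the kernel of this map has
    the dimension by which R_n /\ K exceeds R_(n+1) /\ K (hasdim_succ).  Hence all
    Fredholm T_[n] have the same index.  The spaces R_n /\ K become constant
    because one of them has finite dimension, so d = dis(T) is finite.  The
    Fredholm property of T_[n] ascends to n + 1, and descends from n + 1 to n when
    R_n /\ K = R_(n+1) /\ K; so T_[d] is Fredholm (b_fredholm_at_dis).  Closedness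
    of the ranges is transported along with the dimensions, upwards because a
    closed subspace stays closed after a finite dimensional extension, downwards
    by a correction argument; both rest on the open mapping theorem
    (bounded_lifting), proved by a gliding hump.

    If A has closed range, then the range of its adjoint is the annihilator of
    its kernel, by bounded_lifting and the Hahn-Banach theorem (range_adjoint).
    With A = T^d and A = T^(d+1) every space on the dual side becomes an
    annihilator: the n-th range of the adjoint is that of K_n for n = d, d + 1;
    its d-th range intersected with its kernel is that of the preimage of R_(d+1)
    under T^d; and the sum of its range and of the kernel of its d-th power is
    that of R_d /\ K, which makes the sum weak-star closed.  Finally T^d identifies
    K_(d+1) / K_d with R_d /\ K and the quotient of X by the preimage of R_(d+1)
    with R_d / R_(d+1), and passing to annihilators preserves the dimension of a
    finite dimensional quotient with closed denominator (hasdim_annihilator).  So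
    alpha and beta are exchanged and the index changes sign. *)

(** * The real-valued norm *)

Section RealNorm.
Set Implicit Arguments.
Unset Strict Implicit.
Context {R : realType}.
Local Notation C := R[i].

Lemma nneg_complexE (z : C) : 0 <= z -> (complex.Re z)%:C%C = z.
Proof. by case: z => a b; rewrite lecE /= => /andP[/eqP -> _]. Qed.

(** Norms take their values in the complex numbers, whose order is partial; the
    real-valued version makes linear arithmetic available. *)
Definition rnorm {V : normedModType C} (x : V) : R := complex.Re `|x|.

Section Basic.
Context {V : normedModType C}.
Implicit Types x y : V.

Lemma normrE_rnorm x : `|x| = (rnorm x)%:C%C.
Proof. by rewrite /rnorm nneg_complexE. Qed.

Lemma rnorm_ge0 x : 0 <= rnorm x.
Proof. by rewrite -(@lecR R) -normrE_rnorm normr_ge0. Qed.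

Lemma rnorm0 : rnorm (0 : V) = 0.
Proof. by rewrite /rnorm normr0. Qed.

Lemma rnormN x : rnorm (- x) = rnorm x.
Proof. by rewrite /rnorm normrN. Qed.

Lemma rnormD x y : rnorm (x + y) <= rnorm x + rnorm y.
Proof. by rewrite -(@lecR R) rmorphD /= -!normrE_rnorm ler_normD. Qed.

Lemma rnormB x y : rnorm (x - y) <= rnorm x + rnorm y.
Proof. by rewrite -(rnormN y) rnormD. Qed.

Lemma rdistC x y : rnorm (x - y) = rnorm (y - x).
Proof. by rewrite -rnormN opprB. Qed.

Lemma rnorm_eq0 x : rnorm x = 0 -> x = 0.
Proof. by move=> x0; apply/eqP; rewrite -normr_eq0 normrE_rnorm x0. Qed.

Lemma rnormZ (c : C) x : rnorm (c *: x) = complex.Re `|c| * rnorm x.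
Proof.
apply: (@complexI R); rewrite rmorphM /= (nneg_complexE (normr_ge0 c)).
by rewrite -!normrE_rnorm normrZ.
Qed.

Lemma rnormZR (a : R) x : rnorm (a%:C%C *: x) = `|a| * rnorm x.
Proof. by rewrite rnormZ normc_def /= expr0n /= addr0 sqrtr_sqr. Qed.

Lemma rnorm_gt0 x : x != 0 -> 0 < rnorm x.
Proof.
by rewrite lt0r rnorm_ge0 andbT; apply: contra_neq => /rnorm_eq0.
Qed.

Lemma ball_rnormE x (e : R) y : ball x e%:C%C y = (rnorm (x - y) < e) :> Prop.
Proof.
by rewrite -ball_normE /ball_ /= normrE_rnorm ltcR.
Qed.

Lemma nbhs_rnormP x (P : set V) :
  nbhs x P <-> exists2 e : R, 0 < e & forall y, rnorm (x - y) < e -> P y.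
Proof.
split=> [/nbhs_ballP[e /= e0 eP]|[e e0 eP]].
  have eE := nneg_complexE (ltW e0).
  exists (complex.Re e); first by rewrite -(@ltcR R) eE.
  by move=> y xy; apply: eP; rewrite -eE ball_rnormE.
apply/nbhs_ballP; exists e%:C%C => /=; first by rewrite ltcR.
by move=> y; rewrite ball_rnormE; exact: eP.
Qed.

Lemma closed_rnormP (A : set V) :
  closed A <->
  forall x, (forall e : R, 0 < e -> exists2 y, A y & rnorm (x - y) < e) -> A x.
Proof.
split=> [cA x xA|xA].
  apply: cA => B /nbhs_rnormP[e e0 eB].
  by have [y Ay xy] := xA e e0; exists y; split => //; exact: eB.
move=> x cx; apply: xA => e e0.
have [|y [Ay xy]] := cx [set y | rnorm (x - y) < e]; last by exists y.
by apply/nbhs_rnormP; exists e.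
Qed.

Lemma closed0 : closed [set (0 : V)].
Proof.
apply/closed_rnormP => x h; apply/rnorm_eq0/eqP.
rewrite eq_le rnorm_ge0 andbT leNgt; apply/negP => /h[y ->].
by rewrite subr0 ltxx.
Qed.

End Basic.

Section Operators.
Context {V W : normedModType C}.

Lemma continuous_rbound (f : {linear V -> W}) :
  continuous f -> exists2 M : R, 0 < M & forall x, rnorm (f x) <= M * rnorm x.
Proof.
move=> /linear_bounded_continuous/bounded_funP/(_ 1)[M fM].
have MR : 0 <= M by apply: le_trans (fM 0 _); rewrite ?normr0.
exists (complex.Re M + 1).
  by rewrite ltr_wpDl // -(@lecR R) nneg_complexE.
move=> x; have [->|x0] := eqVneq x 0; first by rewrite linear0 !rnorm0 mulr0.
have nx := rnorm_gt0 x0.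
have : `|f ((rnorm x)^-1%:C%C *: x)| <= M.
  apply: fM; rewrite normrE_rnorm rnormZR ger0_norm ?invr_ge0 ?rnorm_ge0 //.
  by rewrite mulVf ?gt_eqF.
rewrite linearZ /= normrE_rnorm -(nneg_complexE MR) lecR rnormZR.
rewrite ger0_norm ?invr_ge0 ?rnorm_ge0 // ler_pdivrMl // => /le_trans; apply.
by rewrite mulrC ler_pM2r // lerDl.
Qed.

Lemma rbound_continuous (f : {linear V -> W}) (M : R) :
  (forall x, rnorm (f x) <= M * rnorm x) -> continuous f.
Proof.
move=> fM; apply/linear_bounded_continuous/bounded_funP => r.
exists (`|M|%:C%C * `|r|) => x xr; rewrite normrE_rnorm.
rewrite -[`|r|]nneg_complexE // -rmorphM /= lecR (le_trans (fM x)) //.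
rewrite (le_trans (ler_wpM2r (rnorm_ge0 x) (ler_norm M))) //.
apply: ler_wpM2l => //; rewrite -(@lecR R) -normrE_rnorm.
rewrite (nneg_complexE (normr_ge0 r)).
by rewrite (le_trans xr) // real_ler_norm // ger0_real // (le_trans _ xr).
Qed.

Lemma closed_linear_preimage (f : {linear V -> W}) (A : set W) :
  continuous f -> closed A -> closed (f @^-1` A).
Proof. by move=> cf; apply: preimage_closed => x _; exact: cf. Qed.

End Operators.

Lemma geometric_small (q a e : R) : 0 <= q -> q < 1 -> 0 <= a -> 0 < e ->
  exists N, forall n, (N <= n)%N -> a * q ^+ n < e.
Proof.
move=> q0 q1 a0 e0.
have : (fun n => q ^+ n) @ \oo --> (0 : R).
  by apply: cvg_expr; rewrite ger0_norm.
have d0 : 0 < e / (a + 1) by rewrite divr_gt0 // ltr_wpDl.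
move=> /cvgrPdist_lt/(_ _ d0)[N _ Nq]; exists N => n Nn.
have := Nq n Nn; rewrite /= sub0r normrN ger0_norm ?exprn_ge0 //.
rewrite ltr_pdivlMr ?ltr_wpDl // => /le_lt_trans; apply.
by rewrite mulrC ler_wpM2l ?exprn_ge0 // lerDl.
Qed.

(** The explicit bound on the tails is what makes the limit useful: it bounds the
    norm of a preimage built as a series, and keeps a limit away from a set that
    the n-th term avoids by a margin proportional to q^n. *)
Lemma geometric_limit {V : completeNormedModType C} (z : nat -> V) (q a : R) :
  0 <= q -> q < 1 -> 0 <= a ->
  (forall n, rnorm (z n.+1 - z n) <= a * q ^+ n) ->
  exists2 l : V, z @ \oo --> l &
    forall n, rnorm (l - z n) <= a * q ^+ n / (1 - q).
Proof.
move=> q0 q1 a0 zq; have q1' : 0 < 1 - q by rewrite subr_gt0.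
have zD n k : rnorm (z (n + k)%N - z n) <= a * q ^+ n / (1 - q).
  rewrite ler_pdivlMr //.
  suff : rnorm (z (n + k)%N - z n) * (1 - q) <= a * q ^+ n * (1 - q ^+ k).
    move=> /le_trans; apply; apply: ler_piMr; first by rewrite mulr_ge0 ?exprn_ge0.
    by rewrite gerBl exprn_ge0.
  elim: k => [|k IH]; first by rewrite addn0 !subrr rnorm0 mul0r mulr0.
  have -> : z (n + k.+1)%N - z n =
            (z (n + k).+1 - z (n + k)%N) + (z (n + k)%N - z n).
    by rewrite addnS addrA subrK.
  have := ler_wpM2r (ltW q1') (rnormD (z (n + k).+1 - z (n + k)%N) (z (n + k)%N - z n)).
  have := ler_wpM2r (ltW q1') (zq (n + k)%N).
  move: IH; rewrite exprD exprS; nra.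
have : cauchy (z @ \oo).
  apply: cauchy_exP => e e0; have eE := nneg_complexE (ltW e0).
  have e0' : 0 < complex.Re e by rewrite -(@ltcR R) eE.
  have aq : 0 <= a / (1 - q) by rewrite divr_ge0 // ltW.
  have [N Nz] := geometric_small q0 q1 aq e0'.
  exists (z N), N => // n /= Nn; rewrite -eE.
  rewrite /= ball_rnormE rdistC -(subnKC Nn).
  by apply: le_lt_trans (zD _ _) _; rewrite mulrAC Nz.
move=> /cauchy_cvg/cvg_ex[l zl]; exists l => // n.
rewrite leNgt; apply/negP => lt.
have e0 : 0 < rnorm (l - z n) - a * q ^+ n / (1 - q) by rewrite subr_gt0.
have : nbhs l [set y | rnorm (l - y) < rnorm (l - z n) - a * q ^+ n / (1 - q)].
  by apply/nbhs_rnormP; eexists; first exact: e0.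
move=> /zl[N _ /(_ (n + N)%N)]/= /(_ (leq_addl _ _)) lN.
have := zD n N; have := rnormD (l - z (n + N)%N) (z (n + N)%N - z n).
by rewrite addrA subrK; lra.
Qed.

End RealNorm.

(** * Operators with closed range lift boundedly *)

Section BoundedLifting.
Set Implicit Arguments.
Unset Strict Implicit.
Context {R : realType} {V W : completeNormedModType R[i]}.
Variable A : {linear V -> W}.
Hypotheses (cA : continuous A) (clA : closed (range A)).

Let almost_lifts n z :=
  exists2 x : V, rnorm x <= n%:R & rnorm (z - A x) <= 3^-1 ^+ n / 2.

Let not_almost_liftsDB n z y : ~ almost_lifts n y -> almost_lifts n (z + y) ->
  ~ almost_lifts n (z - y).
Proof.
move=> ny [x1 x1n x1z] [x2 x2n x2z]; apply: ny.
have hE (u : W) : rnorm (2^-1%:C%C *: u) = 2^-1 * rnorm u.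
  by rewrite rnormZR ger0_norm.
have hEV (u : V) : rnorm (2^-1%:C%C *: u) = 2^-1 * rnorm u.
  by rewrite rnormZR ger0_norm.
exists (2^-1%:C%C *: (x1 - x2)).
  by rewrite hEV; have := rnormB x1 x2; lra.
have -> : y - A (2^-1%:C%C *: (x1 - x2)) =
    2^-1%:C%C *: ((z + y - A x1) - (z - y - A x2)).
  have {1}-> : y = 2^-1%:C%C *: (y + y).
    rewrite scalerDr -scalerDl -rmorphD /= (_ : 2^-1 + 2^-1 = 1) ?scale1r //.
    by lra.
  rewrite linearZ /= -scalerBr (linearB A); congr (_ *: _).
  by rewrite !opprD !opprK [RHS]addrACA (addrACA z y) subrr add0r.
rewrite hE; have := rnormB (z + y - A x1) (z - y - A x2); lra.
Qed.

(** If no constant worked, there would be vectors y_n of norm 3^-n in the range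
    that are not almost reached from the ball of radius n.  Of z + y_n and
    z - y_n one is not almost reached either, since y_n is half their
    difference; choosing the signs accordingly makes the series of the +- y_n
    converge to a point whose preimages would have norm larger than every n.
    The ratio 3 leaves room: after step n the rest of the series has norm at most
    3^-n / 2, the margin in almost_lifts. *)
Lemma almost_lifting : exists2 K : R, 0 < K &
  forall y, range A y -> exists2 x, rnorm x <= K * rnorm y &
    rnorm (y - A x) <= rnorm y / 2.
Proof.
apply: contrapT => nK.
have bad n : exists2 y, range A y /\ rnorm y = 3^-1 ^+ n & ~ almost_lifts n y.
  apply: contrapT => nb; apply: nK.
  (* Rescaling y to norm 3^-n turns this constant into the radius n + 1. *)
  exists (n.+1%:R * 3 ^+ n); first by rewrite mulr_gt0 ?exprn_gt0.
  move=> y [x0 _ x0y]; apply: contrapT => ny; apply: nb.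
  have y0 : y != 0.
    apply/eqP => y0; apply: ny; exists 0.
      by rewrite rnorm0 mulr_ge0 ?rnorm_ge0 // mulr_ge0 // exprn_ge0.
    by rewrite linear0 subr0 y0 rnorm0 mul0r.
  have yp := rnorm_gt0 y0.
  have t0 : 0 < 3^-1 ^+ n :> R by rewrite exprn_gt0 // invr_gt0.
  pose s : R := 3^-1 ^+ n / rnorm y.
  have s0 : 0 < s by rewrite divr_gt0.
  exists (s%:C%C *: y).
    split; first by exists (s%:C%C *: x0); rewrite // linearZ /= x0y.
    by rewrite rnormZR gtr0_norm // /s divfK ?gt_eqF.
  move=> [x xn xy]; apply: ny; exists (s^-1%:C%C *: x).
    rewrite rnormZR gtr0_norm ?invr_gt0 // /s invfM invrK -exprVn invrK.
    rewrite mulrAC ler_pM2r // mulrC ler_wpM2r ?exprn_ge0 // (le_trans xn) //.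
    by rewrite ler_nat.
  have -> : y - A (s^-1%:C%C *: x) = s^-1%:C%C *: (s%:C%C *: y - A x).
    rewrite scalerBr scalerA -rmorphM /= mulVf ?gt_eqF // scale1r.
    by rewrite linearZ.
  rewrite rnormZR gtr0_norm ?invr_gt0 // ler_pdivrMl // (le_trans xy) //.
  by rewrite /s mulrA divfK ?gt_eqF.
have [y yR ny] : exists2 y : nat -> W,
    forall n, range A (y n) /\ rnorm (y n) = 3^-1 ^+ n &
    forall n, ~ almost_lifts n (y n).
  exists (fun n => sval (cid2 (bad n))) => n; case: cid2 => //=.
pose step n z := if pselect (almost_lifts n (z + y n)) then z - y n else z + y n.
have stepP n z : (step n z = z - y n \/ step n z = z + y n) /\
    ~ almost_lifts n (step n z).
  rewrite /step; case: pselect => h; split; [by left| |by right|by []].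
  exact: not_almost_liftsDB h.
pose fix z n := if n is m.+1 then step m (z m) else 0.
have zstep n : rnorm (z n.+1 - z n) <= 1 * 3^-1 ^+ n.
  rewrite mul1r -(yR n).2 /=.
  have [[->|->] _] := stepP n (z n); rewrite addrAC subrr ?sub0r ?add0r //.
  by rewrite rnormN.
have znot n : ~ almost_lifts n (z n.+1) by have [] := stepP n (z n).
have zran n : range A (z n).
  elim: n => [|n [x _ xz]]; first by exists 0; rewrite ?linear0.
  have [[u _ uy] _] := yR n.
  have [[E|E] _] := stepP n (z n); rewrite /= E; [exists (x - u)|exists (x + u)] => //.
    by rewrite linearB xz uy.
  by rewrite linearD xz uy.
have [||//|l zl lz] := geometric_limit _ _ _ zstep; [by []|lra|].
have : range A l by apply: (closed_cvg (range A)) zl => //; exact: nearW.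
case=> x _ xl; pose n := Num.truncn (rnorm x).
apply: (znot n.+1); exists x; first exact/ltW/Num.Theory.truncnS_gt.
rewrite rdistC xl (le_trans (lz _)) // mul1r exprS.
move: (3^-1 ^+ n.+1 : R) => t; rewrite (_ : 1 - 3^-1 = 2 / 3); last by lra.
by rewrite invf_div; lra.
Qed.

(** The open mapping theorem for an operator with closed range.  Correcting the
    error of an almost lifting again and again halves it each time, and the
    corrections sum up to a preimage. *)
Theorem bounded_lifting : exists2 K : R, 0 < K &
  forall y, range A y -> exists2 x, A x = y & rnorm x <= K * rnorm y.
Proof.
have [K K0 AK] := almost_lifting.
have [h hP] : exists h : W -> V, forall y, range A y ->
    rnorm (h y) <= K * rnorm y /\ rnorm (y - A (h y)) <= rnorm y / 2.
  have /choice[h hP] : forall y, exists x, range A y ->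
      rnorm x <= K * rnorm y /\ rnorm (y - A x) <= rnorm y / 2.
    move=> y; have [/AK[x x1 x2]|ny] := pselect (range A y); first by exists x.
    by exists 0 => /ny.
  by exists h.
exists (2 * K); first by rewrite mulr_gt0.
move=> y yA.
pose w n := iter n (fun v => v - A (h v)) y.
have wR n : range A (w n).
  elim: n => [//|n [x _ xw]] /=; exists (x - h (w n)) => //.
  by rewrite linearB xw.
have wn n : rnorm (w n) <= rnorm y * 2^-1 ^+ n.
  elim: n => [|n IH]; first by rewrite mulr1.
  have [_ /le_trans->//] := hP _ (wR n).
  by rewrite exprSr mulrA ler_pM2r.
pose x n := \sum_(k < n) h (w k).
have xstep n : rnorm (x n.+1 - x n) <= K * rnorm y * 2^-1 ^+ n.
  rewrite /x big_ord_recr /= addrAC subrr add0r.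
  have [/le_trans-> //] := hP _ (wR n).
  by rewrite -mulrA ler_pM2l.
have Ax n : A (x n) = y - w n.
  elim: n => [|n IH]; first by rewrite /x big_ord0 linear0 subrr.
  by rewrite /x big_ord_recr linearD /= -/(x n) IH opprB addrA addrAC.
have half : (1 - 2^-1)^-1 = 2 :> R.
  by rewrite (_ : 1 - 2^-1 = 2^-1) ?invrK //; lra.
have KY : 0 <= K * rnorm y by rewrite mulr_ge0 ?rnorm_ge0 // ltW.
have [||//|l _ lx] := geometric_limit _ _ _ xstep; [by []|lra|].
exists l; last first.
  have := lx 0; rewrite /x big_ord0 subr0 expr0 mulr1 half; lra.
have [M M0 AM] := continuous_rbound cA.
apply/eqP; rewrite -subr_eq0; apply/eqP/rnorm_eq0/eqP.
rewrite eq_le rnorm_ge0 andbT leNgt; apply/negP => lt.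
have B0 : 0 <= M * (K * rnorm y) * 2 + rnorm y.
  by rewrite addr_ge0 ?rnorm_ge0 // mulr_ge0 // mulr_ge0 // ltW.
have h0 : 0 <= 2^-1 :> R by [].
have h1 : 2^-1 < 1 :> R by lra.
have [N /(_ N (leqnn _))] := geometric_small h0 h1 B0 lt.
apply/negP; rewrite -leNgt.
have -> : A l - y = A (l - x N) - w N by rewrite linearB Ax opprB addrA addrAC addrK.
have := rnormB (A (l - x N)) (w N).
have := AM (l - x N); have := ler_wpM2l (ltW M0) (lx N); have := wn N.
by rewrite half; move: (2^-1 ^+ N) => t; lra.
Qed.

End BoundedLifting.

(** * Subspaces as sets *)

Section Subspaces.
Set Implicit Arguments.
Unset Strict Implicit.
Context {R : realType}.

Definition subspace_set {V : lmodType R[i]} (M : set V) :=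
  M 0 /\ forall (a : R[i]) (x y : V), M x -> M y -> M (a *: x + y).

Context {V : lmodType R[i]}.

Lemma subspace_setZ (M : set V) a (x : V) :
  subspace_set M -> M x -> M (a *: x).
Proof. by move=> [M0 MD] Mx; have := MD a x 0 Mx M0; rewrite addr0. Qed.

Lemma subspace_setD (M : set V) (x y : V) :
  subspace_set M -> M x -> M y -> M (x + y).
Proof. by move=> [_ MD] Mx My; have := MD 1 x y Mx My; rewrite scale1r. Qed.

Lemma subspace_setB (M : set V) (x y : V) :
  subspace_set M -> M x -> M y -> M (x - y).
Proof.
by move=> sM Mx My; rewrite -scaleN1r; apply: subspace_setD => //; exact: subspace_setZ.
Qed.

Lemma subspace_set_sum (M : set V) n (c : 'I_n -> R[i]) (e : 'I_n -> V) :
  subspace_set M -> (forall i, M (e i)) -> M (\sum_i c i *: e i).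
Proof.
move=> sM Me; apply: (big_ind M) => [|x y|i _]; first by case: sM.
  exact: subspace_setD.
exact: subspace_setZ.
Qed.

Lemma subspace_setI (M N : set V) :
  subspace_set M -> subspace_set N -> subspace_set (M `&` N).
Proof.
move=> [M0 MD] [N0 ND]; split=> // a x y [Mx Nx] [My Ny].
by split; [exact: MD|exact: ND].
Qed.

Lemma subspace_set0 : subspace_set [set (0 : V)].
Proof. by split=> // a x y -> ->; rewrite /= scaler0 addr0. Qed.

Lemma subspace_preimage (W : lmodType R[i]) (f : {linear V -> W}) (M : set W) :
  subspace_set M -> subspace_set (f @^-1` M).
Proof.
by move=> [M0 MD]; split=> [|a x y fx fy]; rewrite /= ?linear0 ?linearP //; exact: MD.
Qed.

End Subspaces.

(** * The Hahn-Banach theorem *)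

Section RealHahnBanach.
Set Implicit Arguments.
Unset Strict Implicit.
Context {R : realType} {V : lmodType R[i]}.
Implicit Types (G : set (V * R)) (x v : V).

(** Partial functionals are handled as graphs, so that unions of chains need no
    gluing; single-valuedness is a consequence of domination. *)
Definition real_linear_graph G := G (0, 0) /\
  forall (a : R) (u w : V * R), G u -> G w -> G (a%:C%C *: u.1 + w.1, a * u.2 + w.2).

Variable p : V -> R.
Hypothesis pD : forall x y, p (x + y) <= p x + p y.
Hypothesis pZ : forall (t : R) x, 0 <= t -> p (t%:C%C *: x) = t * p x.

Definition dominated_graph G := forall u, G u -> u.2 <= p u.1.

Let extend G v a : set (V * R) :=
  [set w | exists u t, G u /\ w = (u.1 + t%:C%C *: v, u.2 + t * a)].

Let extend_linear G v a : real_linear_graph G -> real_linear_graph (extend G v a).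
Proof.
move=> [G0 GD]; split.
  by exists (0, 0), 0; split; rewrite //= scale0r mul0r !addr0.
move=> b _ _ [u [s [Gu ->]]] [w [t [Gw ->]]] /=.
exists (b%:C%C *: u.1 + w.1, b * u.2 + w.2), (b * s + t); split; first exact: GD.
congr pair; last by rewrite /=; ring.
by rewrite /= scalerDr scalerA addrACA -scalerDl rmorphD rmorphM.
Qed.

(** The value at a new vector v has to lie above all r - p (x - v) and below all
    p (x + v) - r; subadditivity makes the supremum of the former admissible. *)
Let extend_dominated G v : real_linear_graph G -> dominated_graph G ->
  exists a, dominated_graph (extend G v a).
Proof.
move=> [G0 GD] Gp.
have GZ (t : R) u : G u -> G (t%:C%C *: u.1, t * u.2).
  by move=> Gu; have := GD t u _ Gu G0; rewrite !addr0.
pose S := [set u.2 - p (u.1 - v) | u in G].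
have ubS u : G u -> ubound S (p (u.1 + v) - u.2).
  move=> Gu _ [w Gw <-].
  have /Gp := GD 1 w u Gw Gu; rewrite /= scale1r mul1r.
  have -> : w.1 + u.1 = (w.1 - v) + (u.1 + v).
    by rewrite (addrC u.1) addrA subrK.
  by have := pD (w.1 - v) (u.1 + v); lra.
have hS : has_sup S.
  split; first by exists (0 - p (0 - v)), (0, 0).
  by eexists; exact: (ubS (0, 0)).
exists (sup S) => _ [u [t [Gu ->]]] /=.
have [t0|t0|->] := ltgtP t 0.
- have s0 : 0 < - t by rewrite oppr_gt0.
  have us : S ((- t)^-1 * u.2 - p ((- t)^-1%:C%C *: u.1 - v)).
    by exists ((- t)^-1%:C%C *: u.1, (- t)^-1 * u.2) => //; exact: GZ.
  have /(ler_wpM2l (ltW s0)) := ub_le_sup hS.2 us.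
  rewrite mulrBr mulVKf ?gt_eqF // -(pZ _ (ltW s0)) scalerBr scalerA -rmorphM /=.
  rewrite divff ?gt_eqF // scale1r rmorphN scaleNr opprK; lra.
- have /ubS := GZ t^-1 u Gu => /(ge_sup hS.1) /(ler_wpM2l (ltW t0)) /=.
  rewrite mulrBr mulVKf ?gt_eqF // -(pZ _ (ltW t0)) scalerDr scalerA -rmorphM /=.
  by rewrite divff ?gt_eqF // scale1r; lra.
- by rewrite scale0r mul0r !addr0; exact: Gp.
Qed.

Theorem real_hahn_banach G0 : real_linear_graph G0 -> dominated_graph G0 ->
  exists f : V -> R, [/\ forall (a : R) x y, f (a%:C%C *: x + y) = a * f x + f y,
    forall x, f x <= p x & forall u, G0 u -> f u.1 = u.2].
Proof.
move=> lG0 dG0.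
pose good G := [/\ real_linear_graph G, dominated_graph G & G0 `<=` G].
(* The empty set has to be admitted, as the union of the empty chain. *)
have [F Fgood Fchain|A [PA Amax]] := @Zorn_bigcup _ [set G | G = set0 \/ good G].
  have [[B FB gB]|nB] := pselect (exists2 B, F B & good B); last first.
    left; apply/seteqP; split=> // u [B FB Bu].
    case: (Fgood _ FB) => [B0|gB]; last by case: nB; exists B.
    by move: Bu; rewrite B0.
  right; have ne B' u : F B' -> B' u -> good B'.
    by move=> FB' B'u; case: (Fgood _ FB') => // B0; move: B'u; rewrite B0.
  have [[B0 _] _ G0B] := gB; split; last by move=> u /G0B; exists B.
    split; first by exists B.
    move=> a u v [B1 FB1 B1u] [B2 FB2 B2v].
    have [B12|B21] := Fchain _ _ FB1 FB2.
      have [[_ lB2] _ _] := ne _ _ FB2 B2v.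
      by exists B2 => //; apply: lB2 => //; exact: B12.
    have [[_ lB1] _ _] := ne _ _ FB1 B1u.
    by exists B1 => //; apply: lB1 => //; exact: B21.
  by move=> u [B1 FB1 B1u]; have [_ dB1 _] := ne _ _ FB1 B1u; exact: dB1.
have {PA} [lA dA G0A] : good A.
  case: PA => // A0; case: (Amax G0); last by right; split.
  rewrite A0; split; first exact: sub0set.
  by move=> /(_ (0, 0)); apply; case: lG0.
have p0 : p 0 = 0 by have := @pZ 0 0 (lexx _); rewrite scale0r mul0r.
have funA x r r' : A (x, r) -> A (x, r') -> r <= r'.
  move=> Ar Ar'; have /dA := lA.2 (-1) _ _ Ar' Ar.
  by rewrite /= rmorphN1 scaleN1r addNr p0; lra.
have /choice[f fA] : forall v, exists r, A (v, r).
  move=> v; apply: contrapT => nv.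
  have [a da] := extend_dominated v lA dA.
  have AE : A `<=` extend A v a.
    move=> u Au; exists u, 0; split=> //.
    by rewrite scale0r mul0r !addr0; case: (u).
  apply: (Amax (extend A v a)); last first.
    right; split => //; first exact: extend_linear.
    exact: subset_trans G0A AE.
  split=> // /(_ (v, a)) h; apply: nv; exists a; apply: h.
  by exists (0, 0), 1; split; [case: lA|rewrite /= scale1r mul1r !add0r].
have fE x r : A (x, r) -> f x = r.
  by move=> Ar; apply/eqP; rewrite eq_le !(funA x).
exists f; split=> [a x y|x|u /G0A]; last by case: u => x r /fE.
  by apply: fE; exact: (lA.2 a (x, f x) (y, f y)).
exact: (dA (x, f x)).
Qed.

End RealHahnBanach.

Section HahnBanach.
Set Implicit Arguments.
Unset Strict Implicit.
Context {R : realType} {X : normedModType R[i]}.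
Local Notation C := (R[i]^o).
Implicit Types (x v : X) (N : set X).

Lemma rnorm_Complex (a b : R) : rnorm ((a +i* b)%C : C) <= `|a| + `|b|.
Proof.
rewrite /rnorm normc_def /= -[leRHS]ger0_norm ?addr_ge0 // -sqrtr_sqr.
apply: ler_wsqrtr; rewrite -(real_normK (num_real a)) -(real_normK (num_real b)).
by have := normr_ge0 a; have := normr_ge0 b; rewrite !expr2; nra.
Qed.

(** Complex functionals are determined by their real parts u through
    f x = u x - i u (i x), so the real theorem suffices.  The graph form spares
    the well-definedness checks for functionals prescribed as A x |-> g x. *)
Theorem hahn_banach (G : set (X * C)%type) (K : R) :
  subspace_set G -> (forall u, G u -> rnorm u.2 <= K * rnorm u.1) ->
  exists f : dual_space X, forall u, G u -> dual_fun f u.1 = u.2.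
Proof.
move=> [G0 GD] GK.
have ReD (a : R) (z w : R[i]) :
    complex.Re (a%:C%C * z + w) = a * complex.Re z + complex.Re w.
  by case: z w => [s t] [s' t'] /=; rewrite mul0r subr0.
have [||||u [uD up uG]] := @real_hahn_banach R X (fun x => `|K| * rnorm x) _ _
  [set (w.1, complex.Re w.2) | w in G].
- by move=> x y /=; rewrite -mulrDr ler_wpM2l // rnormD.
- by move=> t x t0 /=; rewrite rnormZR (ger0_norm t0) mulrCA.
- split; first by exists (0, 0).
  move=> a _ _ [w Gw <-] [w' Gw' <-] /=.
  exists (a%:C%C *: w + w'); first exact: GD.
  by rewrite /= ReD.
- move=> _ [w /GK wK <-] /=; have := ler_wpM2r (rnorm_ge0 w.1) (ler_norm K).
  have : complex.Re w.2 <= rnorm w.2.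
    rewrite -(@lecR R) -normrE_rnorm; apply: le_trans (normc_ge_Re _).
    by rewrite lecR ler_norm.
  lra.
have u0 : u 0 = 0 by have := uD (-1) 0 0; rewrite scaler0 addr0; lra.
have uB x y : u (x + y) = u x + u y by have := uD 1 x y; rewrite scale1r mul1r.
have uZ (a : R) x : u (a%:C%C *: x) = a * u x.
  by have := uD a x 0; rewrite !addr0 u0 addr0.
pose f x : C := (u x +i* - u ('i%C *: x))%C.
have flin : linear f.
  move=> c x y; have cE : c = ((complex.Re c)%:C + 'i * (complex.Im c)%:C)%C.
    exact: complexE.
  have uc z : u (c *: z) = complex.Re c * u z + complex.Im c * u ('i%C *: z).
    by rewrite {1}cE scalerDl uB uZ (mulrC 'i%C) -scalerA uZ.
  have ii z : u ('i%C *: ('i%C *: z)) = - u z.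
    by rewrite scalerA -expr2 sqr_i scaleN1r -[- z]scaleN1r -(rmorphN1 (@real_complex R)) uZ mulN1r.
  rewrite /f scalerDr !uB scalerA (mulrC 'i%C) -scalerA !uc ii.
  rewrite [c in RHS]complexE; apply/eqP; rewrite eq_complex /=; apply/andP; split; apply/eqP => /=; ring.
pose fL : {linear X -> C} := HB.pack f (GRing.isLinear.Build _ _ _ _ f flin).
have ub x : `|u x| <= `|K| * rnorm x.
  rewrite ler_norml up andbT lerNl.
  have := up (- x); rewrite rnormN.
  by have := uZ (-1) x; rewrite rmorphN1 scaleN1r => ->; rewrite mulN1r.
have ni x : rnorm ('i%C *: x) = rnorm x.
  by rewrite rnormZ normc_def /= expr0n /= expr1n add0r sqrtr1 mul1r.
have fcont : continuous f.
  apply: (@rbound_continuous _ _ _ fL (2 * `|K|)) => x.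
  have := rnorm_Complex (u x) (- u ('i%C *: x)); rewrite normrN.
  have := ub x; have := ub ('i%C *: x); rewrite ni /fL /=; lra.
have fdual : f \in @dual_pred R X by apply/asboolP.
exists (exist _ f fdual) => w Gw; rewrite /dual_fun /= /f.
have -> : u w.1 = complex.Re w.2 by apply: (uG (w.1, complex.Re w.2)); exists w.
have Gi : G ('i%C *: w) by have := GD 'i%C w 0 Gw G0; rewrite addr0.
have -> : u ('i%C *: w.1) = complex.Re ('i%C * w.2).
  by apply: (uG ('i%C *: w.1, complex.Re ('i%C * w.2))); exists ('i%C *: w).
by case: (w.2) => a b /=; rewrite mul0r mul1r sub0r opprK.
Qed.

(** The functional x + c v |-> c on the sum of N and the line through v is bounded
    by the inverse of the distance of v to N. *)
Lemma hahn_banach_separation N v : subspace_set N -> closed N -> ~ N v ->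
  exists2 f : dual_space X, (forall x, N x -> dual_fun f x = 0) & dual_fun f v = 1.
Proof.
move=> sN cN nv.
have [d d0 dv] : exists2 d : R, 0 < d & forall x, N x -> d <= rnorm (v - x).
  apply: contrapT => nd; apply: nv; apply: (closed_rnormP N).1 => // e e0.
  apply: contrapT => ne; apply: nd; exists e => // x Nx; rewrite leNgt.
  by apply/negP => vx; apply: ne; exists x.
pose G : set (X * C) := [set w | N (w.1 - w.2 *: v)].
have [|w Gw|f fG] := @hahn_banach G d^-1.
- split; first by rewrite /G /= scale0r subr0; case: sN.
  move=> a u w; rewrite /G /= => Gu Gw.
  rewrite scalerDl opprD addrACA -scalerA -scalerBr.
  exact: sN.2.
- rewrite ler_pdivlMl //; have [->|c0] := eqVneq w.2 0.
    by rewrite rnorm0 mulr0 rnorm_ge0.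
  have /dv : N ((- w.2^-1) *: (w.1 - w.2 *: v)) by exact: subspace_setZ.
  rewrite scaleNr opprK scalerBr scalerA mulVf // scale1r addrC subrK.
  rewrite rnormZ normfV.
  have nc : 0 < complex.Re `|w.2| by exact: (@rnorm_gt0 R C w.2 c0).
  have -> : complex.Re (`|w.2|^-1) = (complex.Re `|w.2|)^-1.
    by rewrite -[`|w.2| in LHS]nneg_complexE // -fmorphV.
  by rewrite ler_pdivlMl // mulrC.
exists f; first by move=> x Nx; apply: (fG (x, 0)); rewrite /G /= scale0r subr0.
by apply: (fG (v, 1)); rewrite /G /= scale1r subrr; case: sN.
Qed.

End HahnBanach.

(** * Finite dimensional quotients *)

Section FiniteDimension.
Set Implicit Arguments.
Unset Strict Implicit.
Context {R : realType}.
Local Notation C := R[i].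

(** A relational dimension of M / N, which carries its finiteness and stays
    within the natural numbers. *)
Definition hasdim {V : normedModType C} (M N : set V) n :=
  exists e : 'I_n -> V, basis_mod M N e.

Definition free_mod {V : normedModType C} (N : set V) n (e : 'I_n -> V) :=
  forall c : 'I_n -> C, N (\sum_i c i *: e i) -> forall i, c i = 0.

Section OneSpace.
Context {V : normedModType C}.
Implicit Types (L M N : set V).

Lemma basis_modP M N n (e : 'I_n -> V) : subspace_set M -> subspace_set N ->
  basis_mod M N e <->
  [/\ forall i, M (e i), forall x, M x -> exists c, N (x - \sum_i c i *: e i) &
      free_mod N e].
Proof.
move=> sM sN; split=> [[Me uc]|[Me sp fr]].
  split=> // [x /uc[c [Nc _]]|c Nc i]; first by exists c.
  have [c0 [_ c0u]] := uc 0 sM.1.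
  have c00 : c0 = fun=> 0.
    by apply: c0u; rewrite big1 ?subr0 => [|j _]; [exact: sN.1|rewrite scale0r].
  have c0c : c0 = fun i => - c i.
    apply: c0u; rewrite sub0r -sumrN.
    by under eq_bigr do rewrite scaleNr opprK.
  by have /esym/eqP := congr1 (@^~ i) c0c; rewrite c00 oppr_eq0 => /eqP.
split=> // x /sp[c Nc]; exists c; split=> // c' Nc'; apply/funext => i.
apply/eqP; rewrite eq_sym -subr_eq0; apply/eqP.
apply: (fr (fun i => c' i - c i)).
rewrite (_ : \sum_i _ = (x - \sum_i c i *: e i) - (x - \sum_i c' i *: e i)).
  exact: subspace_setB.
rewrite opprB addrC addrA subrK -sumrB; apply: eq_bigr => j _.
by rewrite scalerBl.
Qed.

(** If the rows of the coordinate matrix of f were dependent, the same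
    combination of the entries of f would vanish modulo N. *)
Lemma free_mod_leq M N n m (e : 'I_n -> V) (f : 'I_m -> V) :
  subspace_set M -> subspace_set N ->
  basis_mod M N e -> (forall i, M (f i)) -> free_mod N f -> (m <= n)%N.
Proof.
move=> sM sN /(basis_modP _ sM sN)[_ sp _] Mf fr.
have /choice[P PN] : forall j, exists c, N (f j - \sum_i c i *: e i).
  by move=> j; exact: sp.
pose A : 'M[C]_(m, n) := \matrix_(j, i) P j i.
suff : row_free A by rewrite /row_free => /eqP <-; exact: rank_leq_col.
rewrite -kermx_eq0; apply/rowV0P => v /sub_kermxP vA.
apply/rowP => j; rewrite mxE; apply: (fr (v 0)).
have -> : \sum_i v 0 i *: f i = \sum_j v 0 j *: (f j - \sum_i P j i *: e i).
  under [RHS]eq_bigr do rewrite scalerBr scaler_sumr.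
  rewrite sumrB exchange_big /= [X in _ - X]big1 ?subr0 // => i _.
  under eq_bigr do rewrite scalerA.
  rewrite -scaler_suml; have /rowP/(_ i) := vA; rewrite !mxE => vAi.
  rewrite (eq_bigr (fun k => v 0 k * A k i)) ?vAi ?scale0r // => k _.
  by rewrite mxE.
exact: subspace_set_sum.
Qed.

Lemma hasdim_uniq M N n m : subspace_set M -> subspace_set N ->
  hasdim M N n -> hasdim M N m -> n = m.
Proof.
move=> sM sN [e be] [f bf].
have [Me _ fe] := (basis_modP e sM sN).1 be.
have [Mf _ ff] := (basis_modP f sM sN).1 bf.
by apply/eqP; rewrite eqn_leq (free_mod_leq sM sN bf Me fe) (free_mod_leq sM sN be Mf ff).
Qed.

(** A family of maximal length that is free modulo N spans M modulo N. *)
Lemma bounded_free_hasdim M N n : subspace_set M -> subspace_set N ->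
  (forall m (f : 'I_m -> V), (forall i, M (f i)) -> free_mod N f -> (m <= n)%N) ->
  exists m, hasdim M N m.
Proof.
move=> sM sN bd.
pose P m := `[< exists f : 'I_m -> V, (forall i, M (f i)) /\ free_mod N f >].
have P0 : exists m, P m.
  by exists 0%N; apply/asboolP; exists (fun=> 0); split=> [[]|c _ []].
have Pn m : P m -> (m <= n)%N by move=> /asboolP[f [Mf ff]]; exact: bd ff.
have [m /asboolP[f [Mf ff]] mmax] := ex_maxnP P0 Pn.
exists m, f; apply/basis_modP => //; split=> // x Mx.
pose g i := oapp f x (unlift ord0 i).
have : ~ free_mod N g.
  move=> fg; have /mmax : P m.+1; last by rewrite ltnn.
  by apply/asboolP; exists g; split=> // i; rewrite /g; case: unliftP => [j _|_] /=.
move=> /existsNP[c /not_implyP[Nc /existsNP[i ci]]].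
move: Nc; rewrite big_ord_recl {1}/g unlift_none /=.
under eq_bigr do rewrite /g liftK /=.
have [c0|c0 Nc] := eqVneq (c ord0) 0.
  rewrite c0 scale0r add0r => /ff cl; case: ci.
  by case: (unliftP ord0 i) => [j ->|->].
exists (fun j => - ((c ord0)^-1 * c (lift ord0 j))).
have := subspace_setZ (c ord0)^-1 sN Nc.
rewrite scalerDr scalerA mulVf // scale1r scaler_sumr => Nx.
rewrite (_ : x - _ = x + \sum_(i < m) (c ord0)^-1 *: (c (lift ord0 i) *: f i)) //.
congr (_ + _); rewrite -sumrN; apply: eq_bigr => j _.
by rewrite scaleNr opprK scalerA.
Qed.

Lemma hasdim_add N L M k m : subspace_set N -> subspace_set L -> subspace_set M ->
  N `<=` L -> L `<=` M -> hasdim L N k -> hasdim M L m -> hasdim M N (k + m)%N.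
Proof.
move=> sN sL sM NL LM [e /(basis_modP _ sL sN)[Le spe fre]].
move=> [f /(basis_modP _ sM sL)[Mf spf frf]].
pose g (i : 'I_(k + m)) := match fintype.split i with inl j => e j | inr j => f j end.
have gl j : g (lshift m j) = e j by rewrite /g (unsplitK (inl j)).
have gr j : g (rshift k j) = f j by rewrite /g (unsplitK (inr j)).
have sumg c : \sum_i c i *: g i = \sum_i c (lshift m i) *: e i +
    \sum_i c (rshift k i) *: f i.
  rewrite big_split_ord /=; congr (_ + _); apply: eq_bigr => i _; by rewrite ?gl ?gr.
exists g; apply/basis_modP => //; split.
- move=> i; rewrite /g; case: fintype.split => j //; exact: LM.
- move=> x /spf[c Lc]; have [b Nb] := spe _ Lc.
  exists (fun i => match fintype.split i with inl j => b j | inr j => c j end).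
  rewrite sumg (eq_bigr (fun i => b i *: e i)) => [|i _]; last first.
    by rewrite (unsplitK (inl i)).
  rewrite (eq_bigr (fun i => c i *: f i)) => [|i _]; last first.
    by rewrite (unsplitK (inr i)).
  by rewrite opprD addrA addrAC.
- move=> c; rewrite sumg => Nc.
  have Lee : L (\sum_i c (lshift m i) *: e i) by exact: subspace_set_sum.
  have cr : forall i, c (rshift k i) = 0.
    apply: frf; have := subspace_setB sL (NL _ Nc) Lee.
    by rewrite addrAC subrr add0r.
  have cl : forall i, c (lshift m i) = 0.
    apply: fre; move: Nc; rewrite [X in _ + X]big1 ?addr0 // => i _.
    by rewrite cr scale0r.
  by move=> i; rewrite -(splitK i); case: (fintype.split i) => j; rewrite /= ?cl ?cr.
Qed.

Lemma hasdim_split N L M n : subspace_set N -> subspace_set L -> subspace_set M ->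
  N `<=` L -> L `<=` M -> hasdim M N n ->
  exists k m, [/\ hasdim L N k, hasdim M L m & n = (k + m)%N].
Proof.
move=> sN sL sM NL LM hM; have [e be] := hM.
have [k hk] : exists k, hasdim L N k.
  apply: (@bounded_free_hasdim L N n) => // m f Lf.
  by apply: (free_mod_leq sM sN be) => i; exact: LM.
have [m hm] : exists m, hasdim M L m.
  apply: (@bounded_free_hasdim M L n) => // m f Mf ff.
  by apply: (free_mod_leq sM sN be Mf) => c /NL; exact: ff.
exists k, m; split => //.
exact: hasdim_uniq sM sN hM (hasdim_add sN sL sM NL LM hk hm).
Qed.

Lemma ereal_inf_natE (P : set nat) n : P n -> (forall m, P m -> (n <= m)%N) ->
  ereal_inf [set (k%:R : R)%:E | k in P] = n%:R%:E.
Proof.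
move=> Pn nmin; apply/eqP; rewrite eq_le; apply/andP; split.
  by apply: ereal_inf_lbound; exists n.
by apply: le_ereal_inf_tmp => _ [m /nmin nm <-]; rewrite lee_fin ler_nat.
Qed.

Lemma dim_modE M N n : subspace_set M -> subspace_set N ->
  hasdim M N n -> dim_mod M N = n%:R%:E.
Proof.
move=> sM sN hn; apply: ereal_inf_natE => // m hm.
by rewrite (hasdim_uniq sM sN hn hm).
Qed.

Lemma dim_mod_fin M N : (dim_mod M N < +oo)%E -> exists n, hasdim M N n.
Proof.
move=> fin; apply: contrapT => nh; move: fin.
have E : [set n | exists e : 'I_n -> V, basis_mod M N e] = set0.
  by apply/seteqP; split=> // n h; apply: nh; exists n.
by rewrite /dim_mod E image_set0 ereal_inf0 ltxx.
Qed.

End OneSpace.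

(** The hypotheses say that A induces an isomorphism from M / N onto M' / N'. *)
Lemma hasdim_iso {V W : normedModType C} (A : {linear V -> W})
    (M N : set V) (M' N' : set W) n :
  subspace_set M -> subspace_set N -> subspace_set M' -> subspace_set N' ->
  (forall x, M x -> M' (A x)) ->
  (forall y, M' y -> exists2 x, M x & N' (y - A x)) ->
  (forall x, M x -> N' (A x) <-> N x) ->
  hasdim M N n <-> hasdim M' N' n.
Proof.
move=> sM sN sM' sN' AM AS AN.
have AE c (e : 'I_n -> V) : A (\sum_i c i *: e i) = \sum_i c i *: A (e i).
  by rewrite linear_sum; apply: eq_bigr => i _; rewrite linearZ.
split=> -[e /basis_modP[//|//|Me sp fr]].
  exists (A \o e); apply/basis_modP => //; split=> /=.
  - by move=> i; exact: AM.
  - move=> y /AS[x Mx Nx]; have [c Nc] := sp x Mx; exists c.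
    rewrite -AE -(subrK (A x) y) -addrA -linearB.
    apply: subspace_setD => //; apply/AN => //.
    by apply: subspace_setB => //; exact: subspace_set_sum.
  - move=> c; rewrite -AE => /AN h; apply: fr; apply: h.
    exact: subspace_set_sum.
have /choice[f fP] : forall i, exists x, M x /\ N' (e i - A x).
  by move=> i; have [x] := AS _ (Me i); exists x.
have Nsum c : N' (\sum_i c i *: e i - \sum_i c i *: A (f i)).
  rewrite -sumrB; under eq_bigr do rewrite -scalerBr.
  by apply: subspace_set_sum => // i; exact: (fP i).2.
exists f; apply/basis_modP => //; split=> [i|x Mx|c Nc].
- exact: (fP i).1.
- have [c Nc] := sp _ (AM _ Mx); exists c; apply/AN.
    by apply: subspace_setB => //; apply: subspace_set_sum => // i; exact: (fP i).1.
  rewrite linearB AE -(subrK (\sum_i c i *: e i) (A x)) -addrA.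
  exact: subspace_setD.
- apply: fr; rewrite -(subrK (\sum_i c i *: A (f i)) (\sum_i _)).
  apply: subspace_setD => //; rewrite -AE; apply/AN => //.
  by apply: subspace_set_sum => // i; exact: (fP i).1.
Qed.

End FiniteDimension.

(** * Annihilators *)

Section Annihilators.
Set Implicit Arguments.
Unset Strict Implicit.
Context {R : realType} {X : normedModType R[i]}.
Local Notation C := (R[i]^o).
Implicit Types (x v : X) (N M : set X) (f g : dual_space X).

Definition annihilator M : set (dual_space X) :=
  [set f | forall x, M x -> dual_fun f x = 0].

(** Evaluation at x, named so that it can carry its linear structure. *)
Definition dual_eval x f : C := dual_fun f x.

Lemma dual_eval_linear x : linear (dual_eval x).
Proof. by []. Qed.

HB.instance Definition _ x :=
  GRing.isLinear.Build R[i] (dual_space X) C *:%R (dual_eval x) (dual_eval_linear x).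

Lemma dual_eval_bound x f : rnorm (dual_eval x f) <= rnorm x * rnorm f.
Proof.
rewrite -(@lecR R) rmorphM /= -!normrE_rnorm mulrC dual_normE.
exact: ler_dual_norm.
Qed.

Lemma dual_eval_continuous x : continuous (dual_eval x).
Proof. exact: (rbound_continuous (dual_eval_bound x)). Qed.

Lemma dual_fun_sum n (c : 'I_n -> R[i]) (F : 'I_n -> dual_space X) x :
  dual_fun (\sum_i c i *: F i) x = \sum_i c i * dual_fun (F i) x.
Proof. exact: (linear_sum (dual_eval x)). Qed.

Lemma annihilator_subspace M : subspace_set (annihilator M).
Proof.
split=> [x _|a f g fM gM x Mx]; first exact: (linear0 (dual_eval x)).
by rewrite -/(dual_eval x _) linearP /= /dual_eval fM // gM // scaler0 addr0.
Qed.

Lemma annihilator_bigcap M :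
  annihilator M = \bigcap_(x in M) (dual_eval x @^-1` [set 0]).
Proof. by apply/seteqP; split. Qed.

Lemma closed_annihilator M : closed (annihilator M).
Proof.
rewrite annihilator_bigcap; apply: closed_bigI => x _.
apply: closed_linear_preimage; [exact: dual_eval_continuous|exact: closed0].
Qed.

Lemma weak_star_closed_annihilator M : weak_star_closed (annihilator M).
Proof.
rewrite /weak_star_closed annihilator_bigcap; apply: closed_bigI => x _.
apply: preimage_closed; last exact: closed0.
pose D : dual_space X -> {ptws X -> C} := @dual_fun R X.
have c : continuous (dual_eval x : initial_topology D -> C).
  move=> f; apply: (@continuous_comp (initial_topology D) {ptws X -> C} C D (fun h => h x)).
    exact: initial_continuous.
  exact: (@proj_continuous X (fun=> C) x).
by move=> f _; exact: c.
Qed.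

Definition adjoin N v : set X := [set x | exists c : R[i], N (x - c *: v)].

Lemma adjoin_subspace N v : subspace_set N -> subspace_set (adjoin N v).
Proof.
move=> sN; split; first by exists 0; rewrite scale0r subr0; case: sN.
move=> a x y [c Nx] [d Ny]; exists (a * c + d).
rewrite scalerDl opprD addrACA -scalerA -scalerBr.
exact: sN.2.
Qed.

(** A functional f that vanishes on N with f v = 1 exhibits the sum of N and the
    line through v as the preimage of N under x |-> x - f x v. *)
Lemma closed_adjoin N v : subspace_set N -> closed N -> closed (adjoin N v).
Proof.
move=> sN cN; have [Nv|nv] := pselect (N v).
  rewrite (_ : adjoin N v = N) //; apply/seteqP; split=> [x [c Nx]|x Nx].
    by rewrite -(subrK (c *: v) x); apply: subspace_setD => //; exact: subspace_setZ.
  by exists 0; rewrite scale0r subr0.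
have [f fN fv] := hahn_banach_separation sN cN nv.
pose h x : X := x - dual_fun f x *: v.
have hlin : linear h.
  by move=> a x y; rewrite /h linearP scalerDl opprD addrACA -scalerA -scalerBr.
pose hL : {linear X -> X} := HB.pack h (GRing.isLinear.Build _ _ _ _ h hlin).
have hcont : continuous hL.
  apply: (@rbound_continuous _ _ _ _ (1 + rnorm f * rnorm v)) => x.
  rewrite /hL /= /h mulrDl mul1r (le_trans (rnormB _ _)) // lerD2l rnormZ.
  have := dual_eval_bound x f; have := rnorm_ge0 v.
  rewrite /dual_eval /rnorm => v0 fx; rewrite mulrAC ler_wpM2r //.
  by rewrite (le_trans fx) // mulrC.
rewrite (_ : adjoin N v = hL @^-1` N); first exact: closed_linear_preimage.
apply/seteqP; split=> [x [c Nx]|x Nx]; last by exists (dual_fun f x).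
have := fN _ Nx; rewrite linearB linearZ /= fv => /eqP.
rewrite subr_eq0 => /eqP fx; rewrite /= /h fx.
by rewrite /GRing.scale /= mulr1.
Qed.

Lemma closed_adjoin_family N n (e : 'I_n -> X) : subspace_set N -> closed N ->
  closed [set x | exists c : 'I_n -> R[i], N (x - \sum_i c i *: e i)].
Proof.
elim: n N e => [|n IH] N e sN cN.
  rewrite (_ : [set _ | _] = N) //; apply/seteqP; split=> x /=.
    by case=> c; rewrite big_ord0 subr0.
  by exists (fun=> 0); rewrite big_ord0 subr0.
have := IH (adjoin N (e ord0)) (fun i => e (lift ord0 i))
  (adjoin_subspace _ sN) (closed_adjoin sN cN).
congr closed; apply/seteqP; split=> x /=.
  case=> c [b Nb]; exists (fun i => oapp c b (unlift ord0 i)).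
  rewrite big_ord_recl unlift_none /=; under eq_bigr do rewrite liftK /=.
  by rewrite opprD addrA addrAC.
case=> c Nc; exists (fun i => c (lift ord0 i)), (c ord0).
by move: Nc; rewrite big_ord_recl opprD addrA addrAC.
Qed.

Lemma closed_hasdim N M n : subspace_set N -> subspace_set M -> N `<=` M ->
  closed N -> hasdim M N n -> closed M.
Proof.
move=> sN sM NM cN [e /(basis_modP _ sM sN)[Me sp _]].
have := @closed_adjoin_family N n e sN cN; congr closed.
apply/seteqP; split=> [x [c /NM Mx]|x /sp//].
rewrite -(subrK (\sum_i c i *: e i) x); apply: subspace_setD => //.
exact: subspace_set_sum.
Qed.

(** The functional F i separates e i from the closed sum of N and the span of the
    other vectors. *)
Lemma biorthogonal_family N n (e : 'I_n -> X) : subspace_set N -> closed N ->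
  free_mod N e -> exists F : 'I_n -> dual_space X,
    (forall i, annihilator N (F i)) /\
    (forall i j, dual_fun (F i) (e j) = (i == j)%:R).
Proof.
move=> sN cN fr.
suff /choice[F FP] : forall i, exists f : dual_space X,
    annihilator N f /\ forall j, dual_fun f (e j) = (i == j)%:R.
  by exists F; split=> i; case: (FP i).
(* Replacing e i by 0 keeps the index type while removing e i from the span. *)
move=> i; pose e' j := if j == i then 0 else e j.
pose Ni := [set x | exists c : 'I_n -> R[i], N (x - \sum_i c i *: e' i)].
have sNi : subspace_set Ni.
  split; first by exists (fun=> 0); rewrite big1 ?subr0 => [|j _]; [case: sN|rewrite scale0r].
  move=> a x y [c Nx] [d Ny]; exists (fun j => a * c j + d j).
  under eq_bigr do rewrite scalerDl -scalerA.
  by rewrite big_split /= -scaler_sumr opprD addrACA -scalerBr; exact: sN.2.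
have NNi : N `<=` Ni.
  by move=> x Nx; exists (fun=> 0); rewrite big1 ?subr0 // => j _; rewrite scale0r.
have ei : ~ Ni (e i).
  case=> c Nc.
  suff /fr/(_ i)/eqP : N (\sum_j (if j == i then 1 else - c j) *: e j).
    by rewrite eqxx oner_eq0.
  rewrite (bigD1 i) //= eqxx scale1r; move: Nc.
  rewrite (bigD1 i) //= {1}/e' eqxx scaler0 add0r -sumrN; congr (N (_ + _)).
  by apply: eq_bigr => j /negbTE ji; rewrite /e' ji scaleNr.
have [f fN fe] := hahn_banach_separation sNi (closed_adjoin_family (e := e') sN cN) ei.
exists f; split=> [x /NNi/fN//|j].
have [<-//|ij] := eqVneq i j; apply: fN.
exists (fun k => (k == j)%:R); rewrite (bigD1 j) //= eqxx scale1r.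
rewrite /e' eq_sym (negbTE ij) big1 ?addr0 ?subrr; first by case: sN.
by move=> k /negbTE ->; rewrite scale0r.
Qed.

(** The annihilator of N restricted to M is the dual of M / N; for a finite
    dimensional quotient its dimension is that of the quotient. *)
Lemma hasdim_annihilator N M n : subspace_set N -> subspace_set M -> N `<=` M ->
  closed N -> hasdim M N n -> hasdim (annihilator N) (annihilator M) n.
Proof.
move=> sN sM NM cN [e /(basis_modP _ sM sN)[Me sp fr]].
have [F [FN Fe]] := biorthogonal_family sN cN fr.
have Fsum c j : dual_fun (\sum_i c i *: F i) (e j) = c j.
  rewrite dual_fun_sum (bigD1 j) //= Fe eqxx mulr1 big1 ?addr0 // => i ij.
  by rewrite Fe (negbTE ij) mulr0.
exists F; apply/basis_modP; [exact: annihilator_subspace..|split=> //].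
  move=> h hN; exists (fun j => dual_fun h (e j)) => x /sp[d Nd].
  set g := h - _.
  have gN : annihilator N g.
    apply: (subspace_setB (annihilator_subspace N)) => //.
    exact: (subspace_set_sum _ (annihilator_subspace N)).
  rewrite -(subrK (\sum_i d i *: e i) x) (linearD (dual_fun g)) [X in X + _](gN _ Nd) add0r linear_sum.
  rewrite big1 // => j _; rewrite linearZ /=.
  rewrite (_ : dual_fun g (e j) = 0) ?scaler0 //.
  by rewrite -/(dual_eval _ _) /g linearB /= /dual_eval Fsum subrr.
by move=> c cM j; rewrite -[LHS](Fsum c); exact: cM.
Qed.

End Annihilators.

(** * The range of an adjoint operator *)

Section AdjointRange.
Set Implicit Arguments.
Unset Strict Implicit.
Context {R : realType}.

Section Normed.
Context {X : normedModType R[i]}.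
Variable T : bounded_operator X.

Lemma iter_linear n : linear (iter n T).
Proof. by elim: n => [//|n IH] a x y; rewrite /= IH linearP. Qed.

Lemma iter_continuous n : continuous (iter n T).
Proof.
elim: n => [|n IH] x; first exact: cvg_id.
apply: (@continuous_comp _ _ _ (iter n T) T); first exact: IH.
exact: bounded_operator_continuous.
Qed.

Definition iter_op n : bounded_operator X :=
  @BoundedOperator _ _
    (HB.pack (iter n T) (GRing.isLinear.Build _ _ _ _ (iter n T) (iter_linear n)))
    (@iter_continuous n).

Lemma iter_opE n : iter_op n = iter n T :> (X -> X).
Proof. by []. Qed.

Lemma iter_adjointE n f x :
  dual_fun (iter n (adjoint T) f) x = dual_fun f (iter n T x).
Proof. by elim: n x => [//|n IH] x; rewrite [in RHS]iterSr -IH. Qed.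

Lemma iter_adjoint n : iter n (adjoint T) = adjoint (iter_op n).
Proof. by apply/funext => f; apply/val_inj/funext => x; exact: iter_adjointE. Qed.

End Normed.

(** A functional vanishing on the kernel of A factors through the range of A;
    the factor is bounded because preimages can be chosen with controlled norm,
    and the Hahn-Banach theorem extends it to the whole space. *)
Theorem range_adjoint {X : completeNormedModType R[i]} (A : bounded_operator X) :
  closed (range A) -> range (adjoint A) = annihilator (ker A).
Proof.
move=> clA; apply/seteqP; split=> [_ [g _ <-] x Ax|f fA].
  by rewrite /dual_fun /= (Ax : A x = 0) linear0.
have [K K0 AK] := bounded_lifting (@bounded_operator_continuous _ _ A) clA.
pose G : set (X * R[i]^o)%type := [set w | exists x, w = (A x, dual_fun f x)].
have [||g gG] := @hahn_banach R X G (rnorm f * K).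
- split; first by exists 0; rewrite !linear0.
  by move=> a _ _ [x ->] [y ->]; exists (a *: x + y); rewrite !linearP.
- move=> _ [x ->] /=; have [|u Au uK] := AK (A x); first by exists x.
  have -> : dual_fun f x = dual_eval u f.
    apply/eqP; rewrite -subr_eq0 -linearB; apply/eqP/fA.
    by rewrite /ker /= linearB Au subrr.
  rewrite (le_trans (dual_eval_bound _ _)) // mulrC -mulrA.
  by rewrite ler_wpM2l ?rnorm_ge0.
exists g => //; apply/val_inj/funext => x.
by apply: (gG (A x, dual_fun f x)); exists x.
Qed.

End AdjointRange.

(** * Kernels and ranges of powers *)

Section IteratedRanges.
Set Implicit Arguments.
Unset Strict Implicit.
Context {R : realType} {V : normedModType R[i]}.
Variable S : bounded_operator V.
Local Notation Rg := (iter_range S).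
Local Notation Ker := (ker S).

Lemma image_iter_range n : S @` Rg n = Rg n.+1.
Proof.
apply/seteqP; split=> [_ [_ [x _ <-] <-]|_ [x _ <-]]; first by exists x.
by exists (iter n S x) => //; exists x.
Qed.

Lemma iter_range_succ n : Rg n.+1 `<=` Rg n.
Proof. by move=> _ [x _ <-]; exists (S x) => //; rewrite iterSr. Qed.

Lemma iter_range_leq m n : (m <= n)%N -> Rg n `<=` Rg m.
Proof.
move=> /subnKC <-; elim: (n - m)%N => [|k IH]; first by rewrite addn0.
by rewrite addnS; apply: subset_trans IH; exact: iter_range_succ.
Qed.

Lemma ker_subspace : subspace_set Ker.
Proof. exact: (subspace_preimage S subspace_set0). Qed.

Lemma iter_range_subspace n : subspace_set (Rg n).
Proof.
split; first by exists 0 => //; rewrite -iter_opE linear0.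
move=> a _ _ [x _ <-] [y _ <-]; exists (a *: x + y) => //.
by rewrite -iter_opE linearP.
Qed.

Lemma iter_range_ker_subspace n : subspace_set (Rg n `&` Ker).
Proof. exact: subspace_setI (iter_range_subspace n) ker_subspace. Qed.

(** Modulo the next range, this is the kernel of the map that S induces between
    consecutive quotients of ranges. *)
Definition jump n : set V := Rg n `&` S @^-1` (Rg n.+2).

Lemma jump_subspace n : subspace_set (jump n).
Proof.
apply: subspace_setI; first exact: iter_range_subspace.
exact: (subspace_preimage S (iter_range_subspace _)).
Qed.

Lemma iter_range_jump n : Rg n.+1 `<=` jump n.
Proof.
move=> x Rx; split; first exact: iter_range_succ.
by rewrite /preimage /mkset -image_iter_range; exists x.
Qed.

(** A point of the jump differs from a point of the next range by a vector of the
    kernel, so the jump modulo that range is the part of the kernel that is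
    lost. *)
Lemma iter_range_ker_split n a : hasdim (Rg n `&` Ker) [set 0] a ->
  exists k a', [/\ hasdim (Rg n.+1 `&` Ker) [set 0] a',
    hasdim (jump n) (Rg n.+1) k & a = (a' + k)%N].
Proof.
move=> ha.
have [| | a' [k [ha' hk ak]]] := hasdim_split subspace_set0
    (iter_range_ker_subspace n.+1) (iter_range_ker_subspace n) _ _ ha.
- by move=> _ ->; case: (iter_range_ker_subspace n.+1).
- by move=> x [Rx Kx]; split => //; exact: iter_range_succ.
exists k, a'; split => //.
refine ((@hasdim_iso _ _ _ (idfun : {linear V -> V}) (Rg n `&` Ker)
  (Rg n.+1 `&` Ker) (jump n) (Rg n.+1) k _ _ _ _ _ _ _).1 hk).
- exact: iter_range_ker_subspace.
- exact: iter_range_ker_subspace.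
- exact: jump_subspace.
- exact: iter_range_subspace.
- move=> x [Rx Kx]; split=> //=; rewrite (Kx : S x = 0).
  by case: (iter_range_subspace n.+2).
- move=> y [Ry]; rewrite /= -[iter_range S n.+2]image_iter_range => -[z Rz Sz].
  exists (y - z); last by rewrite /= opprB addrCA subrr addr0.
  split; last by rewrite /ker /= linearB Sz subrr.
  by apply: subspace_setB => //; [exact: iter_range_subspace|exact: iter_range_succ].
- by move=> x [Rx Kx] /=; split => // -[].
Qed.

(** S induces a surjection from one quotient of consecutive ranges to the next,
    whose kernel measures how much of the kernel of S is lost on the way; both
    dimensions drop by the same amount. *)
Lemma hasdim_succ n a b :
  hasdim (Rg n `&` Ker) [set 0] a -> hasdim (Rg n) (Rg n.+1) b ->
  exists a' b', [/\ hasdim (Rg n.+1 `&` Ker) [set 0] a',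
    hasdim (Rg n.+1) (Rg n.+2) b' & (a + b' = a' + b)%N].
Proof.
move=> /iter_range_ker_split[k [a' [ha' hk ->]]] hb.
have sR := iter_range_subspace.
have [x []//|k' [b' [hk' hb' ->]]] := hasdim_split (sR n.+1) (jump_subspace n)
  (sR n) (@iter_range_jump n) _ hb.
exists a', b'; split=> //; last first.
  by rewrite (hasdim_uniq (jump_subspace n) (sR n.+1) hk hk') addnA.
refine ((@hasdim_iso _ _ _ S (Rg n) (jump n) (Rg n.+1) (Rg n.+2) b'
  _ _ _ _ _ _ _).1 hb') => //.
- exact: jump_subspace.
- by move=> x Rx; rewrite -image_iter_range; exists x.
- move=> y; rewrite -[iter_range S n.+1]image_iter_range => -[x Rx <-]; exists x => //.
  by rewrite subrr; case: (sR n.+2).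
- by move=> x Rx; split=> [?|[]].
Qed.

Definition fredholm_dims n a b : Prop := [/\ closed (Rg n), closed (Rg n.+1),
  hasdim (Rg n `&` Ker) [set 0] a & hasdim (Rg n) (Rg n.+1) b].

Lemma alphaE n a : hasdim (Rg n `&` Ker) [set 0] a -> alpha S n = a%:R%:E.
Proof.
move=> ha; apply: dim_modE => //; [exact: iter_range_ker_subspace|exact: subspace_set0].
Qed.

Lemma betaE n b : hasdim (Rg n) (Rg n.+1) b -> beta S n = b%:R%:E.
Proof.
move=> hb; rewrite /beta /codimension image_iter_range; apply: dim_modE => //.
  exact: iter_range_subspace.
exact: iter_range_subspace.
Qed.

Lemma b_fredholm_atP n :
  b_fredholm_at S n <-> exists a b, fredholm_dims n a b.
Proof.
rewrite /b_fredholm_at /fredholm_restr image_iter_range; split.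
  case=> cR [/closed_subspaceP[B cB BE] /dim_mod_fin[a ha] bfin].
  move: bfin; rewrite /beta /codimension image_iter_range => /dim_mod_fin[b hb].
  exists a, b; split=> //; move: BE.
  rewrite (setIidl (@iter_range_succ n)) => <-; exact: closedI.
move=> [a [b [cR cR' ha hb]]]; split=> //; split.
- by apply/closed_subspaceP; exists (Rg n.+1).
- by rewrite (alphaE ha) ltry.
- by rewrite (betaE hb) ltry.
Qed.

Lemma index_restrE n a b : fredholm_dims n a b ->
  index_restr S n = (a%:R%:E - b%:R%:E)%E.
Proof.
move=> h; rewrite /index_restr; case: asboolP => [_|[]]; last first.
  by apply/b_fredholm_atP; exists a, b.
by case: h => _ _ /alphaE -> /betaE ->.
Qed.

Lemma fredholm_dims_uniq n a b a' b' : fredholm_dims n a b ->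
  hasdim (Rg n `&` Ker) [set 0] a' -> hasdim (Rg n) (Rg n.+1) b' ->
  a = a' /\ b = b'.
Proof.
move=> [_ _ ha hb] ha' hb'; split.
  exact: hasdim_uniq (iter_range_ker_subspace n) subspace_set0 ha ha'.
exact: hasdim_uniq (iter_range_subspace n) (iter_range_subspace n.+1) hb hb'.
Qed.

Lemma index_restr_leq m n : (m <= n)%N -> b_fredholm_at S m -> b_fredholm_at S n ->
  index_restr S m = index_restr S n.
Proof.
move=> mn /b_fredholm_atP[a [b hm]] /b_fredholm_atP[a' [b' hn]].
rewrite (index_restrE hm) (index_restrE hn).
suff /(congr1 (fun k => k%:R : R)) : (a + b' = a' + b)%N.
  by rewrite !natrD -!EFinB => E; congr EFin; lra.
have [a1 [b1 [ha1 hb1 E]]] : exists a1 b1,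
    [/\ hasdim (Rg n `&` Ker) [set 0] a1, hasdim (Rg n) (Rg n.+1) b1 &
      (a + b1 = a1 + b)%N].
  rewrite -(subnKC mn); elim: (n - m)%N => [|k [a1 [b1 [ha1 hb1 E]]]].
    by rewrite addn0; case: hm => _ _ ha hb; exists a, b.
  rewrite addnS; have [a2 [b2 [ha2 hb2 E2]]] := hasdim_succ ha1 hb1.
  exists a2, b2; split=> //; lia.
by have [-> ->] := fredholm_dims_uniq hn ha1 hb1.
Qed.

Lemma b_indexE n : b_fredholm_at S n -> b_index S = index_restr S n.
Proof.
move=> hn; have hx : b_fredholm_at S (xget 0%N [set n | b_fredholm_at S n]).
  exact: (@xgetPex _ 0%N [set n | b_fredholm_at S n]) (ex_intro _ n hn).
rewrite /b_index; have [le|/ltnW le] := leqP (xget 0%N [set n | b_fredholm_at S n]) n.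
  exact: index_restr_leq.
by apply/esym/index_restr_leq.
Qed.

(** The intersections of the ranges with the kernel decrease, so they are constant
    from one of minimal dimension on. *)
Lemma stable_iteration n a : hasdim (Rg n `&` Ker) [set 0] a ->
  exists m, forall r, (m <= r)%N -> Rg m `&` Ker = Rg r `&` Ker.
Proof.
move=> ha.
pose P k := `[< exists m, hasdim (Rg m `&` Ker) [set 0] k >].
have exP : exists k, P k by exists a; apply/asboolP; exists n.
have [k /asboolP[m hk] kmin] := ex_minnP exP.
exists m => r mr; have sK := iter_range_ker_subspace.
have sub : Rg r `&` Ker `<=` Rg m `&` Ker.
  by move=> x [Rx Kx]; split => //; exact: iter_range_leq Rx.
have [|k' [l [hk' [e /(basis_modP _ (sK m) (sK r))[_ sp _]] kE]]] :=
    hasdim_split subspace_set0 (sK r) (sK m) _ sub hk.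
  by move=> _ ->; case: (sK r).
have l0 : l = 0%N by have : (k <= k')%N by [apply: kmin; apply/asboolP; exists r]; lia.
apply/seteqP; split=> // x /sp[c]; rewrite big1 ?subr0 // => i _.
by have := ltn_ord i; rewrite [X in (_ < X)%N]l0.
Qed.

Lemma dis_fin n a : hasdim (Rg n `&` Ker) [set 0] a ->
  exists2 d, dis S = d%:R%:E &
    forall r, (d <= r)%N -> Rg d `&` Ker = Rg r `&` Ker.
Proof.
move=> /stable_iteration[m0 hm0].
pose P m := `[< forall r, (m <= r)%N -> Rg m `&` Ker = Rg r `&` Ker >].
have exP : exists m, P m by exists m0; apply/asboolP.
have [d /asboolP hd dmin] := ex_minnP exP.
exists d => //; apply: ereal_inf_natE => // m hm.
by apply: dmin; apply/asboolP.
Qed.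

End IteratedRanges.

(** * Closed ranges and the B-Fredholm property *)

Section ClosedRanges.
Set Implicit Arguments.
Unset Strict Implicit.
Context {R : realType} {X : completeNormedModType R[i]}.

(** An operator with closed range is open onto it, so a subset of the range is
    closed as soon as its preimage is. *)
Lemma closed_of_preimage (A : bounded_operator X) (B : set X) :
  closed (range A) -> B `<=` range A -> closed (A @^-1` B) -> closed B.
Proof.
move=> clA BA clB.
have [K K0 AK] := bounded_lifting (@bounded_operator_continuous _ _ A) clA.
apply/closed_rnormP => y yB.
have [x _ Ax] : range A y.
  by apply: (closed_rnormP _).1 => // e /yB[z /BA]; exists z.
rewrite -Ax; apply: ((closed_rnormP _).1 clB) => e e0.
have [z Bz yz] := yB (e / K) (divr_gt0 e0 K0).
have [|u Au uK] := AK (y - z).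
  by have [w _ Aw] := BA _ Bz; exists (x - w) => //; rewrite linearB Ax Aw.
exists (x - u); first by rewrite /preimage /mkset linearB Ax Au opprB addrC subrK.
rewrite opprB addrC subrK (le_lt_trans uK) //.
by rewrite mulrC -ltr_pdivlMr.
Qed.

Variable T : bounded_operator X.
Local Notation Rg := (iter_range T).
Local Notation Ker := (ker T).

Let bdd n : exists2 M : R, 0 < M & forall x, rnorm (iter n T x) <= M * rnorm x.
Proof. exact: (continuous_rbound (@bounded_operator_continuous _ _ (iter_op T n))). Qed.

Let lifting n : closed (Rg n) -> exists2 K : R, 0 < K &
  forall y, Rg n y -> exists2 x, iter n T x = y & rnorm x <= K * rnorm y.
Proof. exact: (bounded_lifting (@bounded_operator_continuous _ _ (iter_op T n))). Qed.

Lemma closed_iter_preimage n (B : set X) : closed B -> closed (iter n T @^-1` B).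
Proof. exact: (closed_linear_preimage (@bounded_operator_continuous _ _ (iter_op T n))). Qed.

Lemma closed_ker_iter n : closed (ker (iter n T)).
Proof. exact: (closed_iter_preimage (n := n) closed0). Qed.

(** Passing to preimages under the powers of T, the claim becomes that the sum
    of R(T) and the kernel of T^(n+1) is closed; it exceeds the closed sum of
    R(T) and the kernel of T^n by a finite dimension. *)
Lemma closed_iter_range_succ n a : closed (Rg n.+1) ->
  hasdim (Rg n `&` Ker) [set 0] a -> closed (Rg n.+2).
Proof.
move=> cR1 /iter_range_ker_split[k [_ [_ hk _]]].
apply: (@closed_of_preimage (iter_op T n.+1)) => //; first exact: iter_range_succ.
pose P := iter n T @^-1` Rg n.+1; pose Q := iter n.+1 T @^-1` Rg n.+2.
have sP : subspace_set P.
  exact: (subspace_preimage (iter_op T n) (iter_range_subspace T n.+1)).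
have sQ : subspace_set Q.
  exact: (subspace_preimage (iter_op T n.+1) (iter_range_subspace T n.+2)).
have PQ : P `<=` Q.
  by move=> x Px; rewrite /Q /preimage /mkset -image_iter_range; exists (iter n T x).
apply: (@closed_hasdim R X P Q k sP sQ PQ (closed_iter_preimage (n := n) cR1)).
refine ((@hasdim_iso _ _ _ (iter_op T n) Q P (jump T n) (Rg n.+1) k
  _ _ _ _ _ _ _).2 hk) => //.
- exact: jump_subspace.
- exact: iter_range_subspace.
- by move=> x Qx; split => //; exists x.
- move=> y [[x _ <-] Qx]; exists x => //.
  by rewrite /= subrr; case: (iter_range_subspace T n.+1).
Qed.

(** If y is a limit of points z of R(T^n), then T y = T^(n+1) x for some x.
    Lifting the small vector T (y - z) through T^(n+1) corrects z - T^n x to a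
    point of the kernel lying in R(T^n) and close to y - T^n x. *)
Lemma closed_iter_range_pred n : closed (Rg n.+1) -> closed (Rg n `&` Ker) ->
  closed (Rg n).
Proof.
move=> cR1 cRK.
have [K K0 TK] := lifting cR1; have [M M0 TM] := bdd n.
have [m m0 Tm] := bdd 1.
apply/closed_rnormP => y hy.
have : Rg n.+1 (T y).
  apply: ((closed_rnormP _).1 cR1) => e e0.
  have [z Rz yz] := hy (e / m) (divr_gt0 e0 m0).
  exists (T z); first by rewrite -image_iter_range; exists z.
  rewrite -linearB (le_lt_trans (Tm _)) //.
  by rewrite mulrC -ltr_pdivlMr.
case=> x _ Tx.
have sR := iter_range_subspace T.
suff [v _] : (Rg n `&` Ker) (y - iter n T x).
  by rewrite -(subrK (iter n T x) y); apply: subspace_setD => //; exists x.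
apply: ((closed_rnormP _).1 cRK) => e e0.
(* The correction is at most M K m times as long as y - z. *)
have B0 : 0 < 1 + M * (K * m).
  by rewrite addr_gt0 ?mulr_gt0.
have [z Rz yz] := hy (e / (1 + M * (K * m))) (divr_gt0 e0 B0).
have [w _ zw] := Rz.
have [|u Tu uK] := TK (T (y - z)).
  by exists (x - w) => //; rewrite -iter_opE linearB !iter_opE Tx /= zw linearB.
exists (z - iter n T (x - u)).
  split; first by apply: subspace_setB => //; exists (x - u).
  rewrite /ker /mkset linearB -iterS -iter_opE linearB !iter_opE Tx Tu (linearB T y z).
  by rewrite subKr subrr.
have -> : y - iter n T x - (z - iter n T (x - u)) = (y - z) - iter n T u.
  have -> : iter n T (x - u) = iter n T x - iter n T u by exact: (linearB (iter_op T n)).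
  by rewrite opprB !addrA subrK addrAC.
rewrite (le_lt_trans (rnormB _ _)) //.
have := TM u; have := ler_wpM2l (ltW M0) uK.
have := ler_wpM2l (ltW M0) (ler_wpM2l (ltW K0) (Tm (y - z))).
by move: yz; rewrite ltr_pdivlMr // /=; lra.
Qed.

Lemma b_fredholm_at_succ n : b_fredholm_at T n -> b_fredholm_at T n.+1.
Proof.
move=> /b_fredholm_atP[a [b [cR cR1 ha hb]]]; apply/b_fredholm_atP.
have [a' [b' [ha' hb' _]]] := hasdim_succ ha hb.
by exists a', b'; split=> //; exact: closed_iter_range_succ ha.
Qed.

(** When no kernel is lost between R(T^n) and R(T^(n+1)), T induces an isomorphism
    between the two consecutive quotients of ranges. *)
Lemma b_fredholm_at_pred n : Rg n `&` Ker = Rg n.+1 `&` Ker ->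
  b_fredholm_at T n.+1 -> b_fredholm_at T n.
Proof.
move=> E /b_fredholm_atP[a [b [cR1 cR2 ha hb]]]; apply/b_fredholm_atP.
exists a, b; split; rewrite ?E //.
  by apply: closed_iter_range_pred => //; rewrite E; exact: closedI cR1 (closed_ker_iter (n := 1)).
have sR := iter_range_subspace T.
refine ((@hasdim_iso _ _ _ T (Rg n) (Rg n.+1) (Rg n.+1) (Rg n.+2) b
  _ _ _ _ _ _ _).2 hb) => //.
- by move=> x Rx; rewrite -image_iter_range; exists x.
- move=> y; rewrite -[iter_range T n.+1]image_iter_range => -[x Rx <-]; exists x => //.
  by rewrite subrr; case: (sR n.+2).
- move=> x Rx; rewrite -[iter_range T n.+2]image_iter_range; split=> [[z Rz Tz]|Rx1]; last by exists x.
  suff [Rxz _] : (Rg n.+1 `&` Ker) (x - z).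
    by rewrite -(subrK z x); exact: subspace_setD.
  rewrite -E; split; last by rewrite /ker /mkset linearB Tz subrr.
  by apply: subspace_setB => //; exact: iter_range_succ.
Qed.

(** At the degree of stable iteration all later ranges meet the kernel in the
    same space, which lets the Fredholm property descend; above the given index
    it always ascends. *)
Lemma b_fredholm_at_dis n d : b_fredholm_at T n ->
  (forall r, (d <= r)%N -> Rg d `&` Ker = Rg r `&` Ker) -> b_fredholm_at T d.
Proof.
move=> hn hd; have [nd|/ltnW dn] := leqP n d.
  rewrite -(subnKC nd); elim: (d - n)%N => [|k IH]; first by rewrite addn0.
  by rewrite addnS; exact: b_fredholm_at_succ.
move: hn; rewrite -(subnKC dn); elim: (n - d)%N => [|k IH]; first by rewrite addn0.
rewrite addnS => /b_fredholm_at_pred h; apply: IH; apply: h.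
by rewrite -hd ?leq_addr // -hd // leqW // leq_addr.
Qed.

Lemma iter_range_adjoint n : closed (Rg n) ->
  iter_range (adjoint T) n = annihilator (ker (iter n T)).
Proof.
by move=> cR; rewrite /iter_range iter_adjoint; exact: (range_adjoint (A := iter_op T n)).
Qed.

Lemma ker_iter_subspace n : subspace_set (ker (iter n T)).
Proof. exact: (ker_subspace (iter_op T n)). Qed.

Lemma hasdim_ker_iter n a : hasdim (Rg n `&` Ker) [set 0] a ->
  hasdim (ker (iter n.+1 T)) (ker (iter n T)) a.
Proof.
move=> ha.
refine ((@hasdim_iso _ _ _ (iter_op T n) (ker (iter n.+1 T)) (ker (iter n T))
  (Rg n `&` Ker) [set 0] a _ _ _ _ _ _ _).2 ha) => //.
- exact: ker_iter_subspace.
- exact: ker_iter_subspace.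
- exact: iter_range_ker_subspace.
- exact: subspace_set0.
- by move=> x Kx; split=> //; exists x.
- by move=> y [[x _ <-] Kx]; exists x => //; rewrite /= subrr.
Qed.

Lemma hasdim_iter_preimage n b : hasdim (Rg n) (Rg n.+1) b ->
  hasdim [set: X] (iter n T @^-1` Rg n.+1) b.
Proof.
move=> hb; have sR := iter_range_subspace T.
refine ((@hasdim_iso _ _ _ (iter_op T n) [set: X] (iter n T @^-1` Rg n.+1)
  (Rg n) (Rg n.+1) b _ _ _ _ _ _ _).2 hb) => //.
- exact: (subspace_preimage (iter_op T n) (sR n.+1)).
- by move=> x _; exists x.
- by move=> y [x _ <-]; exists x => //; rewrite /= subrr; case: (sR n.+1).
Qed.

(** The functionals g o T^n that vanish on R(T) are those with g vanishing on
    R(T^(n+1)). *)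
Lemma iter_range_ker_adjoint n : closed (Rg n) ->
  iter_range (adjoint T) n `&` ker (adjoint T) =
  annihilator (iter n T @^-1` Rg n.+1).
Proof.
move=> cR; rewrite iter_range_adjoint //; apply/seteqP; split=> f.
  move=> [fK Tf].
  have [g _ gf] : iter_range (adjoint T) n f by rewrite iter_range_adjoint.
  move=> x [w _ Tw]; rewrite -gf iter_adjointE -Tw iterSr -iter_adjointE gf.
  exact: (congr1 (fun h => dual_fun h w) Tf).
move=> fP; split.
  move=> x Kx; apply: fP; rewrite /preimage /mkset (Kx : iter n T x = 0).
  by case: (iter_range_subspace T n.+1).
apply/val_inj/funext => x; apply: (fP (T x)).
by exists x => //; rewrite iterSr.
Qed.

Lemma annihilatorT : annihilator [set: X] = [set 0].
Proof.
apply/seteqP; split=> [f f0|_ ->]; first by apply/val_inj/funext => x; exact: f0.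
by case: (annihilator_subspace [set: X]).
Qed.

(** The spaces on the dual side are annihilators.  T^n identifies the quotients
    whose duals they describe with the kernel and the cokernel of T_[n], which
    therefore exchange their dimensions. *)
Lemma fredholm_dims_adjoint n a b :
  fredholm_dims T n a b -> fredholm_dims (adjoint T) n b a.
Proof.
move=> [cR cR1 ha hb]; split.
- by rewrite iter_range_adjoint //; exact: closed_annihilator.
- by rewrite iter_range_adjoint //; exact: closed_annihilator.
- rewrite iter_range_ker_adjoint // -annihilatorT.
  apply: hasdim_annihilator (hasdim_iter_preimage hb) => //.
    exact: (subspace_preimage (iter_op T n) (iter_range_subspace T n.+1)).
  exact: closed_iter_preimage.
- rewrite !iter_range_adjoint //.
  apply: hasdim_annihilator (hasdim_ker_iter ha).
  + exact: ker_iter_subspace.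
  + exact: ker_iter_subspace.
  + by move=> x; rewrite /ker /mkset /= => ->; rewrite linear0.
  + exact: closed_ker_iter.
Qed.

(** The left-hand side consists of the h whose image under the n-th power of the
    adjoint lies in the range of the next power, the annihilator of the kernel
    of T^(n+1); and T^n maps this kernel onto R(T^n) intersected with the kernel
    of T. *)
Lemma range_ker_adjoint_annihilator n : closed (Rg n.+1) ->
  [set f + g | f in range (adjoint T) & g in ker (iter n (adjoint T))] =
  annihilator (Rg n `&` Ker).
Proof.
move=> cR1; apply/seteqP; split=> [_ [_ [f _ <-]] [g Kg <-] x [[w _ <-] Kx]|h hK].
  have E : dual_fun (adjoint T f + g) (iter n T w) =
      dual_fun f (T (iter n T w)) + dual_fun g (iter n T w) by [].
  rewrite E (Kx : T _ = 0) linear0 add0r -iter_adjointE.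
  exact: (congr1 (fun h => dual_fun h w) Kg).
have : iter_range (adjoint T) n.+1 (iter n (adjoint T) h).
  rewrite iter_range_adjoint // => x Kx; rewrite iter_adjointE; apply: hK.
  by split; [exists x|].
case=> f _ fh; exists (adjoint T f); first by exists f.
exists (h - adjoint T f); last by rewrite addrC subrK.
rewrite /ker /mkset -(iter_opE (adjoint T)) linearB !iter_opE.
by rewrite -iterSr fh subrr.
Qed.

End ClosedRanges.

(** * Duality for B-Fredholm operators *)

Theorem corollary2p27 (R : realType) (X : completeNormedModType R[i])
    (T : bounded_operator X) :
  dimension [set: X] = +oo%E ->
  b_fredholm T ->
  exists d : nat,
    [/\ dis T = d%:R%:E,
        weak_star_closed
          [set f + g | f in range (adjoint T) & g in ker (iter d (adjoint T))],
        b_fredholm (adjoint T),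
        alpha T d = beta (adjoint T) d /\ beta T d = alpha (adjoint T) d &
        [/\ b_index T = index_restr T d,
            index_restr T d = (- index_restr (adjoint T) d)%E &
            (- index_restr (adjoint T) d = - b_index (adjoint T))%E]].
Proof.
move=> _ [n0 hn0].
have [a0 [b0 [_ _ ha0 _]]] := (b_fredholm_atP T n0).1 hn0.
have [d disE stable] := dis_fin ha0.
have hd := b_fredholm_at_dis hn0 stable.
have [a [b hab]] := (b_fredholm_atP T d).1 hd.
have hba := fredholm_dims_adjoint hab.
have hd' : b_fredholm_at (adjoint T) d by apply/b_fredholm_atP; exists b, a.
have [_ cR1 ha hb] := hab; have [_ _ hb' ha'] := hba.
exists d; split=> //.
- by rewrite range_ker_adjoint_annihilator //; exact: weak_star_closed_annihilator.
- by exists d.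
- by rewrite (alphaE ha) (betaE hb) (alphaE hb') (betaE ha').
- rewrite (b_indexE hd) (b_indexE hd') (index_restrE hab) (index_restrE hba).
  by split=> //; rewrite -!EFinB -EFinN opprB.
Qed.
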